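(* Let $\mathfrak{C}$ be a class of groups closed under taking subgroups and finite direct products. Let $G$ be a finitely generated, residually finite group that is locally $\mathfrak{C}$ up to powers. Then $G$ embeds into a finitely generated perfect branch group $\Gamma$ that is locally $\mathfrak{C}$ up to powers.
   Context: A group $\Gamma$ is locally $\mathfrak{C}$ up to powers if for every finite list $\gamma_1,\dots,\gamma_k\in\Gamma$ there are exponents $t_1,\dots,t_k\in\mathbb{N}$ such that $\langle\gamma_1^{t_1},\dots,\gamma_k^{t_k}\rangle$ belongs to $\mathfrak{C}$. A group is a branch group if it is isomorphic to a branch subgroup of the root-preserving automorphism group of a spherically homogeneous rooted tree $\mathcal{T}_X$: for finite sets $X_n$ with $|X_n|\ge2$, the vertices of $\mathcal{T}_X$ are finite words $x_1\cdots x_\ell$ with $x_i\in X_i$, adjacent iff one extends the other by one letter, the empty word being the root. A subgroup is a branch subgroup if it acts transitively on every level and for each $\ell$ the subgroup generated by the rigid stabilizers of the level-$\ell$ vertices has finite index, where the rigid stabilizer of $v$ consists of the elements fixing every vertex that does not have $v$ as initial subword. *)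

(* Defs.v *)
From mathcomp Require Import all_boot.
From Stdlib Require Import ProofIrrelevance.

Set Implicit Arguments.
Unset Strict Implicit.
Unset Printing Implicit Defensive.

Record grp := Grp {
  carrier :> Type;
  gmul : carrier -> carrier -> carrier;
  ginv : carrier -> carrier;
  gone : carrier;
  gmulA : forall x y z, gmul x (gmul y z) = gmul (gmul x y) z;
  gmul1 : forall x, gmul gone x = x;
  gmulV : forall x, gmul (ginv x) x = gone
}.

Arguments gmul {g}.
Arguments ginv {g}.
Arguments gone {g}.

Fixpoint gpow (G : grp) (x : G) (n : nat) : G :=
  match n with 0 => gone | n'.+1 => gmul x (gpow x n') end.

Definition gcomm (G : grp) (a b : G) : G :=
  gmul (gmul (ginv a) (ginv b)) (gmul a b).

Definition is_hom (G H : grp) (f : G -> H) : Prop :=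
  forall x y, f (gmul x y) = gmul (f x) (f y).

Definition isomorphic (G H : grp) : Prop :=
  exists f : G -> H, is_hom f /\ bijective f.

Definition embeds (G H : grp) : Prop :=
  exists f : G -> H, is_hom f /\ injective f.

Definition is_subgroup (G : grp) (S : G -> Prop) : Prop :=
  [/\ S gone, (forall x y, S x -> S y -> S (gmul x y)) & (forall x, S x -> S (ginv x))].

Section Sub.
Variables (G : grp) (S : G -> Prop) (hS : is_subgroup S).
Definition sub_car := {x : G | S x}.
Definition sub_mul (x y : sub_car) : sub_car :=
  exist _ (gmul (proj1_sig x) (proj1_sig y))
    (let: And3 _ hm _ := hS in hm _ _ (proj2_sig x) (proj2_sig y)).
Definition sub_inv (x : sub_car) : sub_car :=
  exist _ (ginv (proj1_sig x)) (let: And3 _ _ hi := hS in hi _ (proj2_sig x)).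
Definition sub_one : sub_car := exist _ gone (let: And3 h1 _ _ := hS in h1).
Lemma sub_mulA x y z : sub_mul x (sub_mul y z) = sub_mul (sub_mul x y) z.
Proof. apply: eq_sig_hprop => [? ? ?|]; [exact: proof_irrelevance|exact: gmulA]. Qed.
Lemma sub_mul1 x : sub_mul sub_one x = x.
Proof. case: x => x hx; apply: eq_sig_hprop => [? ? ?|]; [exact: proof_irrelevance|exact: gmul1]. Qed.
Lemma sub_mulV x : sub_mul (sub_inv x) x = sub_one.
Proof. apply: eq_sig_hprop => [? ? ?|]; [exact: proof_irrelevance|exact: gmulV]. Qed.
Definition subgrp : grp := Grp sub_mulA sub_mul1 sub_mulV.
End Sub.

Definition gen (G : grp) (A : G -> Prop) : G -> Prop :=
  fun x => forall S : G -> Prop, is_subgroup S -> (forall y, A y -> S y) -> S x.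

Lemma gen_is_subgroup (G : grp) (A : G -> Prop) : is_subgroup (gen A).
Proof.
split.
- by move=> S [h1 _ _] _.
- by move=> x y hx hy S hS hA; case: (hS) => _ hm _; apply: hm; [apply: hx|apply: hy].
- by move=> x hx S hS hA; case: (hS) => _ _ hi; apply: hi; apply: hx.
Qed.

Definition gen_grp (G : grp) (A : G -> Prop) : grp := subgrp (gen_is_subgroup A).

Section Prod.
Variables G H : grp.
Definition prod_mul (x y : G * H) : G * H := (gmul x.1 y.1, gmul x.2 y.2).
Definition prod_inv (x : G * H) : G * H := (ginv x.1, ginv x.2).
Definition prod_one : G * H := (gone, gone).
Lemma prod_mulA x y z : prod_mul x (prod_mul y z) = prod_mul (prod_mul x y) z.
Proof. by rewrite /prod_mul /= !gmulA. Qed.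
Lemma prod_mul1 x : prod_mul prod_one x = x.
Proof. by case: x => a b; rewrite /prod_mul /= !gmul1. Qed.
Lemma prod_mulV x : prod_mul (prod_inv x) x = prod_one.
Proof. by rewrite /prod_mul /= !gmulV. Qed.
Definition prodgrp : grp := Grp prod_mulA prod_mul1 prod_mulV.
End Prod.

Definition group_class (C : grp -> Prop) : Prop :=
  forall G H : grp, isomorphic G H -> C G -> C H.

Definition subgroup_closed (C : grp -> Prop) : Prop :=
  forall (G : grp) (S : G -> Prop) (hS : is_subgroup S), C G -> C (subgrp hS).

(* closure under finite direct products (binary products suffice, together
   with the trivial group obtained as a subgroup) *)
Definition dirprod_closed (C : grp -> Prop) : Prop :=
  forall G H : grp, C G -> C H -> C (prodgrp G H).

Definition finitely_generated (G : grp) : Prop :=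
  exists (k : nat) (gam : 'I_k -> G), forall x, gen (fun y => exists i, y = gam i) x.

Definition is_normal (G : grp) (N : G -> Prop) : Prop :=
  is_subgroup N /\ forall g n, N n -> N (gmul (gmul g n) (ginv g)).

Definition finite_index (G : grp) (S : G -> Prop) : Prop :=
  exists (k : nat) (r : 'I_k -> G), forall g, exists i, S (gmul (ginv (r i)) g).

Definition residually_finite (G : grp) : Prop :=
  forall x : G, x <> gone ->
    exists N : G -> Prop, [/\ is_normal N, finite_index N & ~ N x].

Definition perfect (G : grp) : Prop :=
  forall g : G, gen (fun x => exists a b, x = gcomm a b) g.

Definition locally_up_to_powers (C : grp -> Prop) (G : grp) : Prop :=
  forall (k : nat) (gam : 'I_k -> G), exists t : 'I_k -> nat,
    (forall i, 0 < t i) /\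
    C (gen_grp (fun x => exists i, x = gpow (gam i) (t i))).

(* X_{i+1} = {0, ..., m i - 1}; a vertex is a word x_1 ... x_l with x_{i+1} < m i *)
Definition valid_word (m : nat -> nat) (v : seq nat) : bool :=
  all (fun i => nth 0 v i < m i) (iota 0 (size v)).

Definition vertex (m : nat -> nat) := {v : seq nat | valid_word m v}.

Definition root (m : nat -> nat) : vertex m := exist _ [::] isT.

Definition is_prefix (u v : seq nat) : bool := take (size u) v == u.

Definition adjacent (m : nat -> nat) (u v : vertex m) : Prop :=
  let u' := proj1_sig u in let v' := proj1_sig v in
  (size v' = (size u').+1 /\ is_prefix u' v') \/
  (size u' = (size v').+1 /\ is_prefix v' u').

Definition tree_action (m : nat -> nat) (Gam : grp) (rho : Gam -> vertex m -> vertex m) : Prop :=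
  [/\ (forall v, rho gone v = v),
      (forall g h v, rho (gmul g h) v = rho g (rho h v)),
      (forall g u v, adjacent u v -> adjacent (rho g u) (rho g v)) &
      (forall g, rho g (root m) = root m)].

Definition faithful_action (m : nat -> nat) (Gam : grp) (rho : Gam -> vertex m -> vertex m) : Prop :=
  forall g, (forall v, rho g v = v) -> g = gone.

Definition level_transitive (m : nat -> nat) (Gam : grp) (rho : Gam -> vertex m -> vertex m) : Prop :=
  forall u v : vertex m, size (proj1_sig u) = size (proj1_sig v) -> exists g, rho g u = v.

Definition rist (m : nat -> nat) (Gam : grp) (rho : Gam -> vertex m -> vertex m)
  (v : vertex m) : Gam -> Prop :=
  fun g => forall w : vertex m, ~~ is_prefix (proj1_sig v) (proj1_sig w) -> rho g w = w.

Definition rist_level (m : nat -> nat) (Gam : grp) (rho : Gam -> vertex m -> vertex m)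
  (l : nat) : Gam -> Prop :=
  gen (fun g => exists v : vertex m, size (proj1_sig v) = l /\ rist rho v g).

(* Gam is a branch group: via a faithful action, Gam is isomorphic to its image,
   a subgroup of Aut(T_X), and that image is a branch subgroup. *)
Definition branch_group (Gam : grp) : Prop :=
  exists (m : nat -> nat) (rho : Gam -> vertex m -> vertex m),
    [/\ (forall n, 2 <= m n), tree_action rho, faithful_action rho,
        level_transitive rho & (forall l, finite_index (rist_level rho l))].

(* Main.v *)
Require Import Defs.
From mathcomp Require Import all_boot all_fingroup cyclic all_algebra zify.
From Stdlib Require Import ProofIrrelevance FunctionalExtensionality.
From Stdlib Require Import Classical ClassicalEpsilon.
Import GRing.Theory.

(* First G is embedded into a finitely generated perfect group B inside a wreath product of G with
   a symmetric group.  Let g_1, ..., g_k generate G.  Modulo commutators, some multiple d of the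
   identity of the abelianization factors through homomorphisms chi_j : G -> Z followed by
   powers of the g_j.  Hence the tuple of d copies of x together with the entries g_j^(- chi_j x)
   has trivial product in the abelianization, and such tuples lie in the group B generated by
   the 3-cycles and the elements with entries g_l and g_l^-1 in two coordinates, which is perfect.

   Then B is embedded into a Segal type group acting on a tree with levels X_n, generated by rooted
   permutations and by directed elements spin b, with section spin b at a point o of X_n, rooted
   sections rho_i b at points y_i, and trivial sections elsewhere.  Commutators of directed
   elements isolate the rooted sections, so every Gamma_n contains the copies of Gamma_(n+1) below
   the points of X_n; this gives the branch property, while perfectness is inherited from B.

   Powers: let a word have s directed letters.  The section of its l-th power at a point with orbit
   of length l has at most s directed letters and at most s |I| rooted ones, |I| being the number
   of kinds of rooted letters, because each letter meets o, and each y_i, at most once along the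
   orbit.  The y_i are chosen so far from o that no orbit of such a word passes through both once
   n >= s; then the section is directed or has finite order, and powers live in copies of B.  Such
   y_i exist by counting: X_n contains an r by r grid of coordinates on which only 2 r copies of a
   fixed finite group act, one for each row and each column, so words reach far fewer points than
   there are. *)

Set Implicit Arguments.
Unset Strict Implicit.
Unset Printing Implicit Defensive.

(** * Groups, permutation groups, and closure properties of the class *)

Local Notation "x ** y" := (gmul x y) (at level 40, left associativity).

Section GroupLaws.
Variable G : grp.
Implicit Types x y z : G.

Lemma gmulKV x y : ginv x ** (x ** y) = y.
Proof. by rewrite gmulA gmulV gmul1. Qed.

Lemma gmul_cancel x y z : x ** y = x ** z -> y = z.
Proof. by move=> h; rewrite -(gmulKV x y) h gmulKV. Qed.

Lemma gmulVr x : x ** ginv x = gone.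
Proof. by rewrite -{1}(gmulKV (ginv x) x) gmulV -gmulA gmul1 gmulV. Qed.

Lemma gmul1r x : x ** gone = x.
Proof. by rewrite -(gmulV x) gmulA gmulVr gmul1. Qed.

Lemma gmulK x y : x ** (ginv x ** y) = y.
Proof. by rewrite gmulA gmulVr gmul1. Qed.

Lemma gmulrK x y : y ** x ** ginv x = y.
Proof. by rewrite -gmulA gmulVr gmul1r. Qed.

Lemma gmulrKV x y : y ** ginv x ** x = y.
Proof. by rewrite -gmulA gmulV gmul1r. Qed.

Lemma ginv_eq x y : x ** y = gone -> ginv x = y.
Proof. by move=> h; apply: (@gmul_cancel x); rewrite h gmulVr. Qed.

Lemma ginvK x : ginv (ginv x) = x.
Proof. by apply: ginv_eq; rewrite gmulV. Qed.

Lemma ginv1 : ginv (gone : G) = gone.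
Proof. by apply: ginv_eq; rewrite gmul1. Qed.

Lemma ginvM x y : ginv (x ** y) = ginv y ** ginv x.
Proof. by apply: ginv_eq; rewrite -gmulA gmulK gmulVr. Qed.

Lemma gmulV_eq x y : ginv x ** y = gone -> x = y.
Proof. by move/ginv_eq; rewrite ginvK. Qed.

Lemma gcomm1r x : gcomm x gone = gone.
Proof. by rewrite /gcomm ginv1 !gmul1r gmulV. Qed.

Lemma gcomm1l x : gcomm gone x = gone.
Proof. by rewrite /gcomm ginv1 !gmul1 gmulV. Qed.

Lemma gpowD x a b : gpow x (a + b) = gpow x a ** gpow x b.
Proof. by elim: a => [|a IH]; rewrite ?gmul1 //= IH gmulA. Qed.

Lemma gpow1 x : gpow x 1 = x.
Proof. exact: gmul1r. Qed.

Lemma gpowSr x n : gpow x n.+1 = gpow x n ** x.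
Proof. by rewrite -addn1 gpowD gpow1. Qed.

Lemma gpow_one n : gpow (gone : G) n = gone.
Proof. by elim: n => //= n ->; rewrite gmul1. Qed.

Lemma gpowM x a b : gpow x (a * b) = gpow (gpow x a) b.
Proof. by elim: b => [|b IH]; rewrite ?muln0 // mulnS gpowD IH. Qed.

End GroupLaws.

Section Homs.
Variables (G H : grp) (f : G -> H).
Hypothesis hf : is_hom f.

Lemma hom1 : f gone = gone.
Proof. by apply: (@gmul_cancel _ (f gone)); rewrite -hf !gmul1r. Qed.

Lemma homV x : f (ginv x) = ginv (f x).
Proof. by symmetry; apply: ginv_eq; rewrite -hf gmulVr hom1. Qed.

Lemma hom_pow x n : f (gpow x n) = gpow (f x) n.
Proof. by elim: n => [|n IH] /=; rewrite ?hom1 // hf IH. Qed.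

Lemma hom_comm x y : f (gcomm x y) = gcomm (f x) (f y).
Proof. by rewrite /gcomm !hf !homV. Qed.

Lemma hom_inj : (forall x, f x = gone -> x = gone) -> injective f.
Proof.
by move=> h x y e; apply: gmulV_eq; apply: h; rewrite hf homV e gmulV.
Qed.

Lemma subgroup_preim (S : H -> Prop) : is_subgroup S -> is_subgroup (fun x => S (f x)).
Proof.
case=> h1 hM hV; split=> [|x y hx hy|x hx]; rewrite ?hom1 ?hf ?homV //; first exact: hM.
exact: hV.
Qed.

End Homs.

Section Subgroups.
Variable G : grp.
Implicit Types (S A : G -> Prop).

Lemma sub1 S : is_subgroup S -> S gone. Proof. by case. Qed.
Lemma subM S x y : is_subgroup S -> S x -> S y -> S (x ** y). Proof. by case=> _ h _; exact: h. Qed.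
Lemma subV S x : is_subgroup S -> S x -> S (ginv x). Proof. by case=> _ _; exact. Qed.

Lemma sub_pow S x n : is_subgroup S -> S x -> S (gpow x n).
Proof. by move=> hS hx; elim: n => [|n IH] /=; [exact: sub1|exact: subM]. Qed.

Lemma sub_comm S x y : is_subgroup S -> S x -> S y -> S (gcomm x y).
Proof. by move=> hS hx hy; rewrite /gcomm; do !apply: subM => //; exact: subV. Qed.

Lemma sub_mulr S x y : is_subgroup S -> S x -> S (y ** x) -> S y.
Proof. by move=> hS hx hyx; rewrite -(gmulrK x y); apply: subM => //; exact: subV. Qed.

Lemma gen_in A x : A x -> gen A x.
Proof. by move=> hx S _; apply. Qed.

Lemma gen_min A S : is_subgroup S -> (forall x, A x -> S x) -> forall x, gen A x -> S x.
Proof. by move=> hS hA x; apply. Qed.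

Lemma gen_sub A A' : (forall x, A x -> gen A' x) -> forall x, gen A x -> gen A' x.
Proof. by apply: gen_min; exact: gen_is_subgroup. Qed.

End Subgroups.

Lemma gen_hom (G H : grp) (f : G -> H) (A : G -> Prop) (S : H -> Prop) :
  is_hom f -> is_subgroup S -> (forall x, A x -> S (f x)) -> forall x, gen A x -> S (f x).
Proof. by move=> hf hS; apply: gen_min; exact: subgroup_preim. Qed.

Lemma sig_inj (T : Type) (P : T -> Prop) (x y : {t | P t}) : proj1_sig x = proj1_sig y -> x = y.
Proof. by move=> h; apply: eq_sig_hprop => // *; exact: proof_irrelevance. Qed.

(** Elements of [subgrp] carry membership proofs, so generation is shown in the ambient group and
    lifted: the elements with a generated lift form a subgroup. *)
Lemma gen_lift (G : grp) (S : G -> Prop) (hS : is_subgroup S) (A : G -> Prop)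
    (A' : subgrp hS -> Prop) :
  (forall y, A y -> exists hy : S y, gen A' (exist _ y hy : subgrp hS)) ->
  forall x : subgrp hS, gen A (proj1_sig x) -> gen A' x.
Proof.
move=> hA x hx.
pose S' z := exists hz : S z, gen A' (exist _ z hz : subgrp hS).
have hS' : is_subgroup S'.
  have hg := gen_is_subgroup A'; split.
  - exists (sub1 hS); have := sub1 hg.
    by congr gen; exact: sig_inj.
  - move=> u v [hu gu] [hv gv]; exists (subM hS hu hv); have := subM hg gu gv.
    by congr gen; exact: sig_inj.
  - move=> u [hu gu]; exists (subV hS hu); have := subV hg gu.
    by congr gen; exact: sig_inj.
have [hz gz] := hx S' hS' hA; move: gz.
by congr gen; exact: sig_inj.
Qed.

Lemma fg_subgrp (G : grp) (S : G -> Prop) (hS : is_subgroup S) (s : seq G) :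
  (forall x, List.In x s -> S x) -> (forall x, S x -> gen (fun z => List.In z s) x) ->
  finitely_generated (subgrp hS).
Proof.
move=> hs hgen.
pose F (i : 'I_(size s)) : subgrp hS :=
  let x := nth gone s i in
  if excluded_middle_informative (S x) is left h then exist _ x h else gone.
exists (size s), F => x.
have nthIn : forall (l : seq G) j, j < size l -> List.In (nth gone l j) l.
  by elim=> // a l IH [|j] /= hj; [left|right; exact: IH].
have Innth : forall (l : seq G) z, List.In z l -> exists2 j, j < size l & z = nth gone l j.
  elim=> // a l IH z /= [->|/IH[j hj ->]]; first by exists 0.
  by exists j.+1.
have FE i : proj1_sig (F i) = nth gone s i.
  rewrite /F; case: excluded_middle_informative => // h.
  by case: h; apply: hs; exact: nthIn.
apply: gen_lift (hgen _ (proj2_sig x)) => z hz; exists (hs z hz); apply: gen_in.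
have [j hj zj] := Innth _ _ hz; exists (Ordinal hj).
by apply: sig_inj; rewrite FE.
Qed.

Lemma perfect_subgrp (G : grp) (S : G -> Prop) (hS : is_subgroup S) :
  (forall x, S x -> gen (fun z => exists a b, [/\ S a, S b & z = gcomm a b]) x) ->
  perfect (subgrp hS).
Proof.
move=> h x; apply: gen_lift (h _ (proj2_sig x)) => z [a [b [ha hb ->]]].
exists (sub_comm hS ha hb); apply: gen_in.
by exists (exist _ a ha), (exist _ b hb); apply: sig_inj.
Qed.

(** The inverse is kept as data so that group inverses compute; [bij_ext] shows that it does not
    affect equality. *)
Record bij (T : Type) := Bij {
  bf :> T -> T; bi : T -> T; bfK : cancel bf bi; biK : cancel bi bf }.

Lemma bij_ext (T : Type) (f g : bij T) : (forall x, f x = g x) -> f = g.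
Proof.
case: f g => [f f' fK f'K] [g g' gK g'K] /= h.
have e : f = g by apply: functional_extensionality.
subst g; have e' : f' = g' by apply: functional_extensionality => x; rewrite -{1}(g'K x) fK.
subst g'; congr Bij; exact: proof_irrelevance.
Qed.

Section PermGroup.
Variable T : Type.
Definition bmul (f g : bij T) : bij T :=
  Bij (can_comp (bfK f) (bfK g)) (can_comp (biK g) (biK f)).
Definition binv (f : bij T) : bij T := Bij (biK f) (bfK f).
Definition bone : bij T := Bij (frefl id : cancel id id) (frefl id).
Lemma bmulA f g h : bmul f (bmul g h) = bmul (bmul f g) h. Proof. exact: bij_ext. Qed.
Lemma bmul1 f : bmul bone f = f. Proof. exact: bij_ext. Qed.
Lemma bmulV f : bmul (binv f) f = bone. Proof. by apply: bij_ext => x /=; rewrite bfK. Qed.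
Definition permgrp : grp := Grp bmulA bmul1 bmulV.
End PermGroup.

Lemma bf_inj (T : Type) (f : bij T) : injective f.
Proof. exact: can_inj (bfK f). Qed.

Lemma bpowE (T : Type) (f : permgrp T) n x : (gpow f n : bij T) x = iter n (f : bij T) x.
Proof. by elim: n => //= n ->. Qed.

Section ClassC.
Variable C : grp -> Prop.
Hypothesis Ciso : group_class C.
Hypothesis Csub : subgroup_closed C.
Hypothesis Cprod : dirprod_closed C.

Lemma C_embeds (H K : grp) : embeds H K -> C K -> C H.
Proof.
case=> f [hf fi] hK.
pose S y := exists x, y = f x.
have hS : is_subgroup S.
  split; first by exists gone; rewrite hom1.
  - by move=> _ _ [x ->] [y ->]; exists (x ** y); rewrite hf.
  - by move=> _ [x ->]; exists (ginv x); rewrite homV.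
apply: (Ciso _ (Csub hS hK)).
have ex (y : subgrp hS) : {x | proj1_sig y = f x}.
  by apply: constructive_indefinite_description; case: y.
exists (fun y => proj1_sig (ex y)); split.
  move=> x y; apply: fi; case: (ex x) (ex y) (ex (x ** y)) => [a ha] [b hb] [c hc] /=.
  by rewrite -hc hf -ha -hb.
exists (fun x => exist _ (f x) (ex_intro _ x erefl)) => [y|x].
  by apply: sig_inj => /=; case: (ex y).
by apply: fi; case: (ex _).
Qed.

(** [f] is multiplicative only on [S]: the intended maps are coordinates and sections, which are
    homomorphisms only on elements with trivial permutation part. *)
Lemma C_sub (G H : grp) (S : G -> Prop) (S' : H -> Prop)
    (hS : is_subgroup S) (hS' : is_subgroup S') (f : G -> H) :
  (forall x y, S x -> S y -> f (x ** y) = f x ** f y) ->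
  (forall x, S x -> S' (f x)) ->
  (forall x, S x -> f x = gone -> x = gone) ->
  C (subgrp hS') -> C (subgrp hS).
Proof.
move=> fM fS fi; apply: C_embeds.
pose F (x : subgrp hS) : subgrp hS' := exist _ (f (proj1_sig x)) (fS _ (proj2_sig x)).
have hF : is_hom F by move=> x y; apply: sig_inj => /=; exact: fM (proj2_sig x) (proj2_sig y).
exists F; split=> //; apply: hom_inj => // x /(congr1 (@proj1_sig _ _)) /= e.
by apply: sig_inj; exact: (fi _ (proj2_sig x) e).
Qed.

Section Family.
Variables (I : Type) (Q : grp).
Definition fun_mul (f g : I -> Q) : I -> Q := fun i => f i ** g i.
Definition fun_inv (f : I -> Q) : I -> Q := fun i => ginv (f i).
Definition fun_one : I -> Q := fun=> gone.
Lemma fun_mulA f g h : fun_mul f (fun_mul g h) = fun_mul (fun_mul f g) h.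
Proof. by apply: functional_extensionality => i; exact: gmulA. Qed.
Lemma fun_mul1 f : fun_mul fun_one f = f.
Proof. by apply: functional_extensionality => i; exact: gmul1. Qed.
Lemma fun_mulV f : fun_mul (fun_inv f) f = fun_one.
Proof. by apply: functional_extensionality => i; exact: gmulV. Qed.
Definition fungrp : grp := Grp fun_mulA fun_mul1 fun_mulV.
End Family.

(** The coordinates [p c] embed [S] into the finite direct product of the groups [V c]. A member [K]
    of the class supplies the empty product as its trivial subgroup. *)
Lemma C_family (I : eqType) (Q H : grp) (cs : seq I) (S : H -> Prop) (hS : is_subgroup S)
    (V : I -> Q -> Prop) (p : I -> H -> Q) :
  (exists K, C K) ->
  (forall c, is_subgroup (V c)) -> (forall c (hV : is_subgroup (V c)), c \in cs -> C (subgrp hV)) ->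
  (forall c x, c \in cs -> S x -> V c (p c x)) ->
  (forall c x y, S x -> S y -> p c (x ** y) = p c x ** p c y) ->
  (forall x, S x -> (forall c, c \in cs -> p c x = gone) -> x = gone) ->
  C (subgrp hS).
Proof.
move=> [K0 hK0] hV CV pV pM pinj.
pose U (l : seq I) (f : fungrp I Q) := forall c, if c \in l then V c (f c) else f c = gone.
have hU l : is_subgroup (U l).
  split.
  - by move=> c; case: ifP => // _; exact: sub1.
  - move=> f g hf hg c; move: (hf c) (hg c); case: ifP => _ /=; rewrite /fun_mul.
      exact: subM.
    by move=> -> ->; rewrite gmul1.
  - move=> f hf c; move: (hf c); case: ifP => _ /=; rewrite /fun_inv; first exact: subV.
    by move=> ->; rewrite ginv1.
have CU l : {subset l <= cs} -> C (subgrp (hU l)).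
  elim: l => [|c l IH] hl.
    have h1 : is_subgroup (fun x : K0 => x = gone).
      by split=> // [x y -> ->|x ->]; rewrite ?gmul1 ?ginv1.
    apply: (C_embeds _ (Csub h1 hK0)).
    exists (fun=> gone); split; first by move=> x y; rewrite gmul1.
    move=> x y _; apply: sig_inj; apply: functional_extensionality => i.
    by rewrite (proj2_sig x i) (proj2_sig y i).
  have Cl : C (subgrp (hU l)) by apply: IH => i hi; apply: hl; rewrite inE hi orbT.
  have Cc : C (subgrp (hV c)) by apply: CV; apply: hl; rewrite inE eqxx.
  apply: (C_embeds _ (Cprod Cl Cc)).
  pose r (f : fungrp I Q) : fungrp I Q := fun i => if i \in l then f i else gone.
  have rU f : U (c :: l) f -> U l (r f).
    by move=> hf i; move: (hf i); rewrite /r inE; case: (i \in l); rewrite ?orbT.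
  have cU (g : fungrp I Q) : U (c :: l) g -> V c (g c).
    by move=> hg; move: (hg c); rewrite inE eqxx.
  pose F (x : subgrp (hU (c :: l))) : prodgrp (subgrp (hU l)) (subgrp (hV c)) :=
    (exist _ (r (proj1_sig x)) (rU _ (proj2_sig x)),
     exist _ (proj1_sig x c) (cU _ (proj2_sig x))).
  have hF : is_hom F.
    move=> x y; rewrite /F /= /prod_mul /=; congr (_, _); last exact: sig_inj.
    apply: sig_inj => /=; apply: functional_extensionality => i.
    by rewrite /r /fun_mul; case: ifP; rewrite ?gmul1.
  exists F; split=> //; apply: hom_inj => // x e.
  have e1 : r (proj1_sig x) = gone by move/(congr1 (fun z => proj1_sig z.1)): e.
  have e2 : proj1_sig x c = gone by move/(congr1 (fun z => proj1_sig z.2)): e.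
  apply: sig_inj; apply: functional_extensionality => i.
  move: (congr1 (fun g : fungrp I Q => g i) e1) (proj2_sig x i); rewrite /r inE.
  by case: eqP => [->|_] //=; case: ifP.
apply: (@C_sub H (fungrp I Q) S (U cs) hS (hU cs) (fun x c => if c \in cs then p c x else gone)).
- move=> x y hx hy; apply: functional_extensionality => c /=; rewrite /fun_mul.
  by case: ifP => _; rewrite ?gmul1 // pM.
- by move=> x hx c /=; case: ifP => hc; rewrite hc //; apply: pV.
- move=> x hx e; apply: pinj => // c hc.
  by move: (congr1 (fun f : fungrp I Q => f c) e) => /=; rewrite hc.
- exact: CU.
Qed.

Definition powC (G : grp) (k : nat) (u : 'I_k -> G) :=
  exists t : 'I_k -> nat, (forall i, 0 < t i) /\ C (gen_grp (fun x => exists i, x = gpow (u i) (t i))).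

End ClassC.

(** * Branch groups of tree portraits *)

#[local] Arguments gmul : simpl never.
#[local] Arguments ginv : simpl never.
#[local] Arguments gone : simpl never.

Lemma boneE (T : Type) (x : T) : ((gone : permgrp T) : bij T) x = x.
Proof. by []. Qed.

Lemma bmulE (T : Type) (f g : permgrp T) (x : T) :
  ((f ** g : permgrp T) : bij T) x = (f : bij T) ((g : bij T) x).
Proof. by []. Qed.

Lemma binvE (T : Type) (f : permgrp T) (x : T) : ((ginv f : permgrp T) : bij T) x = bi f x.
Proof. by []. Qed.

(* An automorphism of the tree of all words over nat is encoded by its portrait:
   the local permutation at every word, with no compatibility condition. *)
Section Portraits.
Implicit Types a b c : seq nat -> bij nat.

Fixpoint act a w := if w is x :: w' then a [::] x :: act (fun v => a (x :: v)) w' else [::].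
Fixpoint acti a w :=
  if w is x :: w' then bi (a [::]) x :: acti (fun v => a (bi (a [::]) x :: v)) w' else [::].

Definition pmul a b : seq nat -> bij nat := fun w => bmul (a (act b w)) (b w).
Definition pinv a : seq nat -> bij nat := fun w => binv (a (acti a w)).
Definition pone : seq nat -> bij nat := fun=> bone nat.

Lemma act_pmul a b w : act (pmul a b) w = act a (act b w).
Proof. by elim: w a b => //= x w IH a b; rewrite -IH. Qed.

Lemma act_pone w : act pone w = w.
Proof. by elim: w => //= x w IH; congr cons; exact: IH. Qed.

Lemma pmulA a b c : pmul a (pmul b c) = pmul (pmul a b) c.
Proof.
apply: functional_extensionality => w; apply: bij_ext => x.
by rewrite /pmul /= act_pmul.
Qed.

Lemma pmul1 a : pmul pone a = a.
Proof. by apply: functional_extensionality => w; apply: bij_ext. Qed.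

Lemma actK a w : acti a (act a w) = w.
Proof. by elim: w a => //= x w IH a; rewrite bfK IH. Qed.

Lemma pmulV a : pmul (pinv a) a = pone.
Proof.
apply: functional_extensionality => w; apply: bij_ext => x.
by rewrite /pmul /pinv /= actK bfK.
Qed.

Definition port : grp := Grp pmulA pmul1 pmulV.

Definition rt (a : port) : permgrp nat := a [::].
Definition sec (a : port) (x : nat) : port := fun w => a (x :: w).
Definition rooted (s : permgrp nat) : port := fun w => if w is [::] then s else bone nat.
Definition at_ (x : nat) (a : port) : port :=
  fun w => if w is z :: v then if z == x then a v else bone nat else bone nat.
Definition atw (v : seq nat) (a : port) : port := foldr at_ a v.

End Portraits.

Lemma port_eq (a b : port) : rt a = rt b -> (forall x, sec a x = sec b x) -> a = b.
Proof.
move=> h0 h; apply: functional_extensionality => -[//|x w].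
exact: (congr1 (fun c : port => c w) (h x)).
Qed.

Lemma rt_hom : is_hom rt. Proof. by []. Qed.

Lemma sec_mul (a b : port) x : sec (a ** b) x = sec a ((rt b : bij nat) x) ** sec b x.
Proof. by []. Qed.

Lemma sec_inv (a : port) x : sec (ginv a) x = ginv (sec a (bi (rt a) x)).
Proof. by []. Qed.

Lemma sec1 x : sec gone x = gone. Proof. by []. Qed.
Lemma rt_rooted s : rt (rooted s) = s. Proof. by []. Qed.
Lemma sec_rooted s x : sec (rooted s) x = gone. Proof. by []. Qed.
Lemma rt_at x a : rt (at_ x a) = gone. Proof. by []. Qed.
Lemma sec_at x a z : sec (at_ x a) z = if z == x then a else gone.
Proof. by rewrite /sec /at_; case: eqP. Qed.

Lemma rooted_hom : is_hom rooted.
Proof. by move=> s t; apply: port_eq => // x; rewrite sec_mul !sec_rooted gmul1. Qed.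

Lemma at_hom x : is_hom (at_ x).
Proof.
move=> a b; apply: port_eq => [|z]; first by rewrite rt_hom !rt_at gmul1.
by rewrite sec_mul !sec_at rt_at boneE; case: eqP; rewrite ?gmul1.
Qed.

Lemma rooted_conj_at (s : permgrp nat) x a :
  rooted s ** at_ x a ** ginv (rooted s) = at_ ((s : bij nat) x) a.
Proof.
apply: port_eq => [|z]; first by rewrite !rt_hom rt_at gmul1r -rt_hom gmulVr.
rewrite !sec_mul sec_inv !sec_rooted ginv1 gmul1r gmul1 !sec_at /=.
by rewrite -(can2_eq (biK s) (bfK s)).
Qed.

Lemma sec_mul0 (a b : port) x : rt b = gone -> sec (a ** b) x = sec a x ** sec b x.
Proof. by move=> hb; rewrite sec_mul hb. Qed.

Lemma sec_inv0 (a : port) x : rt a = gone -> sec (ginv a) x = ginv (sec a x).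
Proof. by move=> ha; rewrite sec_inv ha. Qed.

Lemma sec_comm0 (a b : port) x : rt a = gone -> rt b = gone ->
  sec (gcomm a b) x = gcomm (sec a x) (sec b x).
Proof.
move=> ha hb; have hab : rt (a ** b) = gone by rewrite rt_hom ha hb gmul1.
by rewrite /gcomm !sec_mul0 ?sec_inv0 // (homV rt_hom) hb ginv1.
Qed.

Lemma act_mul (a b : port) w : act (a ** b) w = act a (act b w).
Proof. exact: act_pmul. Qed.

Lemma act_one w : act (gone : port) w = w.
Proof. exact: act_pone. Qed.

Lemma act_cons (a : port) x w : act a (x :: w) = (rt a : bij nat) x :: act (sec a x) w.
Proof. by []. Qed.

Lemma size_act (a : port) w : size (act a w) = size w.
Proof. by elim: w a => //= x w IH a; rewrite (IH (sec a x)). Qed.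

Lemma act_cat (a : port) u w : act a (u ++ w) = act a u ++ act (foldl sec a u) w.
Proof. by elim: u a => //= x u IH a; rewrite -(IH (sec a x)). Qed.

Lemma act_inj (a : port) : injective (act a).
Proof. exact: can_inj (actK a). Qed.

Lemma act_atw v a w : ~~ is_prefix v w -> act (atw v a) w = w.
Proof.
rewrite /is_prefix; elim: v w => [|x v IH] w /=; first by rewrite take0.
case: w => // z w; rewrite act_cons rt_at sec_at /=.
rewrite eqseq_cons; case: eqP => [_ /= h|_ _]; by rewrite ?act_one ?IH.
Qed.

(** An automorphism fixing the first level is the product of its sections placed at their points;
    the induction splits off the section at the largest point and erases it. *)
Lemma sec_split_mem (S : port -> Prop) (hS : is_subgroup S) (M : nat) (a : port) :
  rt a = gone -> (forall x, M <= x -> sec a x = gone) ->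
  (forall x, x < M -> S (at_ x (sec a x))) -> S a.
Proof.
move=> ra; elim: M a ra => [|M IH] a ra h0 h.
  suff -> : a = gone by exact: sub1.
  by apply: port_eq => // x; rewrite h0.
pose b : port := fun w => if w is x :: v then if x == M then bone nat else a w else bone nat.
have sb x : sec b x = if x == M then gone else sec a x by rewrite /sec /b; case: eqP.
have -> : a = at_ M (sec a M) ** b.
  apply: port_eq => [|x]; first by rewrite rt_hom rt_at gmul1.
  have -> : sec (at_ M (sec a M) ** b) x = sec (at_ M (sec a M)) x ** sec b x by [].
  by rewrite sec_at sb; case: eqP => [->|_]; rewrite ?gmul1r ?gmul1.
apply: subM (h _ (leqnn _)) _ => //.
apply: IH => // x hx; rewrite sb; case: eqP => // ne.
  by apply: h0; rewrite ltn_neqAle hx andbT eq_sym; apply/eqP.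
  by move: hx; rewrite ne ltnn.
by apply: h; exact: leqW.
Qed.

(** One representative is chosen for each attained value of [F]; the dummy [gone] stands for the
    values not attained. *)
Lemma finite_index_by (G : grp) (S : G -> Prop) (Phi : finType) (F : G -> Phi) :
  (forall g h, F g = F h -> S (ginv g ** h)) -> finite_index S.
Proof.
move=> h; exists #|Phi|.
exists (fun j => if excluded_middle_informative (exists g, F g = enum_val j) is left e
  then proj1_sig (constructive_indefinite_description _ e) else gone).
move=> g; exists (enum_rank (F g)); apply: h.
case: excluded_middle_informative => [e|[]]; last by exists g; rewrite enum_rankK.
by case: constructive_indefinite_description => /= x ->; rewrite enum_rankK.
Qed.

Lemma In_map (T : eqType) (U : Type) (f : T -> U) (s : seq T) x : x \in s -> List.In (f x) (map f s).
Proof. by elim: s => // y s IH; rewrite inE => /orP[/eqP ->|/IH]; [left|right]. Qed.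

Lemma map_In (T U : Type) (f : T -> U) (s : seq T) z : List.In z (map f s) -> exists x, z = f x.
Proof. by elim: s => // y s IH /= [<-|//]; exists y. Qed.

(** * The Segal type group of a system of finite actions of [B] *)

Section TreeGroup.
Variables (B : grp) (m : nat -> nat) (I : nat -> finType).
Variables (rho : forall n, I n -> B -> permgrp nat) (o : nat -> nat) (y : forall n, I n.+1 -> nat).

Hypothesis m2 : forall n, 2 <= m n.
Hypothesis rho_hom : forall n (i : I n), is_hom (rho i).
Hypothesis rho_out : forall n (i : I n) b x, m n <= x -> (rho i b : bij nat) x = x.
Hypothesis o_lt : forall n, o n < m n.
Hypothesis y_lt : forall n (i : I n.+1), y i < m n.
Hypothesis y_neq_o : forall n (i : I n.+1), y i != o n.
Hypothesis y_inj : forall n, injective (@y n).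

(** The wreath recursion of a directed automorphism never ends along the ray [o n], [o n.+1], ...;
    recursion on the word turns it into a definition. The rooted elements hang at the points [y i]
    beside the ray. *)
Fixpoint spin n (b : B) (w : seq nat) {struct w} : bij nat :=
  match w with
  | [::] => bone nat
  | x :: w' =>
      if x == o n then spin n.+1 b w'
      else if [pick i | @y n i == x] is Some i then rooted (rho i b) w' else bone nat
  end.

Definition spinp n b : port := spin n b.

Definition spin_sec n x (b : B) : port :=
  if x == o n then spinp n.+1 b
  else if [pick i | @y n i == x] is Some i then rooted (rho i b) else gone.

Lemma rt_spin n b : rt (spinp n b) = gone. Proof. by []. Qed.

Lemma sec_spin n b x : sec (spinp n b) x = spin_sec n x b.
Proof.
rewrite /sec /spin_sec; apply: functional_extensionality => w /=.
by case: eqP => // _; case: pickP.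
Qed.

Lemma spin_sec_o n b : spin_sec n (o n) b = spinp n.+1 b.
Proof. by rewrite /spin_sec eqxx. Qed.

Lemma spin_sec_y n (i : I n.+1) b : spin_sec n (y i) b = rooted (rho i b).
Proof.
rewrite /spin_sec (negbTE (y_neq_o i)); case: pickP => [j /eqP/y_inj -> //|/(_ i)].
by rewrite eqxx.
Qed.

Variant spin_sec_spec n x : Prop :=
  | SpinO of x = o n
  | SpinY (i : I n.+1) of x = y i
  | SpinOut of (forall b, spin_sec n x b = gone).

Lemma spin_secP n x : spin_sec_spec n x.
Proof.
case: (x =P o n) => [|ne]; first exact: SpinO.
case: (pickP (fun i => @y n i == x)) => [i /eqP <-|h]; first exact: (@SpinY _ _ i).
apply: SpinOut => b; rewrite /spin_sec; case: eqP => // _; case: pickP => // i.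
by rewrite h.
Qed.

Lemma spinp_hom n : is_hom (spinp n).
Proof.
move=> b c; apply: functional_extensionality => w.
elim: w n => [|x w IH] n; first by apply: bij_ext.
change (sec (spinp n (b ** c)) x w = sec (spinp n b ** spinp n c) x w).
rewrite sec_mul !sec_spin rt_spin /=.
rewrite /spin_sec; case: eqP => _; first exact: IH.
by case: pickP => [i _|_]; rewrite ?gmul1 // rho_hom rooted_hom.
Qed.

(** There is one group for each level, since sections of [Gam n] lie in [Gam n.+1] rather than in
    [Gam n]; the branch group is [Gam 0]. *)
Definition gens n : port -> Prop :=
  fun a => (exists (i : I n) b, a = rooted (rho i b)) \/ exists b, a = spinp n b.
Definition Gam n : port -> Prop := gen (gens n).
Definition Rt n : permgrp nat -> Prop := gen (fun s => exists (i : I n) b, s = rho i b).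

Lemma Gam_subgroup n : is_subgroup (Gam n). Proof. exact: gen_is_subgroup. Qed.

Lemma Gam_spin n b : Gam n (spinp n b). Proof. by apply: gen_in; right; exists b. Qed.

Lemma Gam_rooted n s : Rt n s -> Gam n (rooted s).
Proof.
apply: gen_hom; [exact: rooted_hom|exact: Gam_subgroup|].
by move=> _ [i [b ->]]; apply: gen_in; left; exists i, b.
Qed.

Lemma Rt_rho n (i : I n) b : Rt n (rho i b). Proof. by apply: gen_in; exists i, b. Qed.

(** Portraits live on the tree over all of [nat]. This invariant confines an element to the letters
    below [m n] and puts its sections into the group of the next level. *)
Definition tame n (a : port) :=
  [/\ forall x, m n <= x -> (rt a : bij nat) x = x,
      forall x, x < m n -> Gam n.+1 (sec a x) & forall x, m n <= x -> sec a x = gone].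

Lemma fix_lt k (s : bij nat) x : (forall z, k <= z -> s z = z) -> x < k -> s x < k.
Proof.
move=> h hx; rewrite ltnNge; apply/negP => hk.
have e : s x = x by exact: bf_inj (h _ hk).
by move: hk; rewrite e leqNgt hx.
Qed.

Lemma fix_inv k (s : bij nat) x : (forall z, k <= z -> s z = z) -> k <= x -> bi s x = x.
Proof. by move=> h hx; rewrite -{1}(h _ hx) bfK. Qed.

Lemma tame_subgroup n : is_subgroup (tame n).
Proof.
split.
- by split=> // x _; rewrite sec1; exact: sub1 (Gam_subgroup _).
- move=> a b [ra sa oa] [rb sb ob]; split=> x hx.
  + by rewrite rt_hom bmulE rb // ra.
  + rewrite sec_mul; apply: subM (Gam_subgroup _) _ _; last exact: sb.
    by apply: sa; exact: fix_lt hx.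
  + by rewrite sec_mul rb // oa // ob // gmul1.
- move=> a [ra sa oa]; split=> x hx.
  + exact: fix_inv hx.
  + rewrite sec_inv; apply: subV (Gam_subgroup _) _; apply: sa.
    exact: (@fix_lt _ (binv (rt a))) (fun z => @fix_inv _ _ z ra) hx.
  + by rewrite sec_inv (fix_inv ra hx) oa // ginv1.
Qed.

Lemma Gam_tame n a : Gam n a -> tame n a.
Proof.
apply: gen_min; first exact: tame_subgroup.
move=> _ [[i [b ->]]|[b ->]]; split=> x hx; rewrite ?rt_rooted ?sec_rooted ?rho_out //.
- exact: sub1 (Gam_subgroup _).
- rewrite sec_spin; case: (spin_secP n x) => [->|i ->|->].
  + rewrite spin_sec_o; exact: Gam_spin.
  + rewrite spin_sec_y; apply: Gam_rooted; exact: Rt_rho.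
  + exact: sub1 (Gam_subgroup _).
- rewrite sec_spin; case: (spin_secP n x) => [xo|i xy|->] //.
  + by move: hx; rewrite xo leqNgt o_lt.
  + by move: hx; rewrite xy leqNgt y_lt.
Qed.

Lemma Gam_sec n a x : Gam n a -> x < m n -> Gam n.+1 (sec a x).
Proof. by move=> /Gam_tame[_ h _]; exact: h. Qed.

Lemma Gam_root_lt n a x : Gam n a -> x < m n -> (rt a : bij nat) x < m n.
Proof. by move=> /Gam_tame[h _ _]; exact: fix_lt. Qed.

Definition dirpt n x := x = o n \/ exists j : I n.+1, x = y j.

Lemma spin_sec_nontriv n x b : spin_sec n x b = gone \/ dirpt n x.
Proof.
by case: (spin_secP n x) => [->|i ->|->]; [right; left|right; right; exists i|left].
Qed.

(** * Branching, level transitivity and perfectness *)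

Section Branching.
Hypothesis B_perfect : perfect B.
Hypothesis Rt_trans : forall n x z, x < m n -> z < m n -> exists2 s, Rt n s & (s : bij nat) x = z.
Hypothesis isolating : forall n (i : I n.+1), exists s,
  [/\ Rt n s, (s : bij nat) (y i) = y i &
   forall x, dirpt n x -> dirpt n ((s : bij nat) x) -> x = y i].

Lemma Gam_at_conj n x z a : x < m n -> z < m n -> Gam n (at_ x a) -> Gam n (at_ z a).
Proof.
move=> hx hz ha; have [s hs <-] := Rt_trans hx hz.
rewrite -rooted_conj_at; have hr := Gam_rooted hs.
apply: subM (Gam_subgroup n) _ _; last exact: subV (Gam_subgroup n) hr.
exact: subM (Gam_subgroup n) hr ha.
Qed.

(* If the permutation [s] moves the support of directed elements off itself except at the fixed
   point [y i], the commutator of a directed element with an [s]-conjugate of another one is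
   supported at [y i] alone. *)
Lemma Gam_at_y n (i : I n.+1) b : Gam n (at_ (y i) (rooted (rho i b))).
Proof.
have h1 : is_hom (fun c => at_ (y i) (rooted (rho i c))).
  by move=> c d; rewrite rho_hom rooted_hom at_hom.
have := B_perfect b; apply: (gen_hom h1 (Gam_subgroup n)) => _ [c [d ->]].
have [s [hs sy sD]] := isolating i.
suff -> : at_ (y i) (rooted (rho i (gcomm c d))) =
          gcomm (spinp n c) (rooted s ** spinp n d ** ginv (rooted s)).
  have hr := Gam_rooted hs; have hG := Gam_subgroup n.
  apply: (sub_comm hG); first exact: Gam_spin.
  apply: (subM hG); last exact: (subV hG hr).
  by apply: (subM hG) => //; exact: Gam_spin.
set u := rooted s ** _ ** _.
have ru : rt u = gone by rewrite /u !rt_hom rt_spin gmul1r -rt_hom gmulVr.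
have su x : sec u x = spin_sec n (bi s x) d.
  by rewrite /u !sec_mul sec_inv !sec_rooted ginv1 gmul1r gmul1 sec_spin.
apply: port_eq => [|x].
  by rewrite (hom_comm rt_hom) ru gcomm1r.
have -> : sec (gcomm (spinp n c) u) x = gcomm (spin_sec n x c) (spin_sec n (bi s x) d).
  by rewrite sec_comm0 // sec_spin su.
rewrite sec_at; case: eqP => [->|ne].
  have -> : bi s (y i) = y i by rewrite -{1}sy bfK.
  rewrite !spin_sec_y.
  by rewrite (hom_comm (rho_hom _)) (hom_comm rooted_hom).
have [->|hx] := spin_sec_nontriv n x c; first by rewrite gcomm1l.
have [->|hbx] := spin_sec_nontriv n (bi s x) d; first by rewrite gcomm1r.
case: ne; rewrite -sy -(sD _ hbx); first by rewrite biK.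
by rewrite biK.
Qed.

Lemma Gam_at_rooted n x s : x < m n -> Rt n.+1 s -> Gam n (at_ x (rooted s)).
Proof.
move=> hx; have h : is_hom (fun u => at_ x (rooted u)) by move=> u v; rewrite rooted_hom at_hom.
apply: (gen_hom h (Gam_subgroup n)) => _ [i [b ->]].
by apply: (@Gam_at_conj _ (y i)) => //; exact: Gam_at_y.
Qed.

(** Let [c] be [spinp n b] with the section at [o n] erased. Its remaining sections are rooted and
    already available, so dividing by [c] leaves the directed section at [o n] alone, and
    transitivity moves it to [x]. *)
Lemma Gam_at_spin n x b : x < m n -> Gam n (at_ x (spinp n.+1 b)).
Proof.
move=> hx; apply: (@Gam_at_conj _ (o n)) => //.
pose c : port := fun w => if w is z :: v then if z == o n then bone nat else spinp n b w else bone nat.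
have sc z : sec c z = if z == o n then gone else spin_sec n z b.
  by rewrite -sec_spin /sec /c; case: eqP.
have hc : Gam n c.
  apply: (@sec_split_mem _ (Gam_subgroup n) (m n)) => // z hz; rewrite sc.
    case: eqP => // _; case: (spin_secP n z) => [zo|i zi|//].
      by move: hz; rewrite zo leqNgt o_lt.
    by move: hz; rewrite zi leqNgt y_lt.
  have h1 : Gam n (at_ z gone) by rewrite (hom1 (at_hom z)); exact: sub1 (Gam_subgroup n).
  case: eqP => // zo; case: (spin_secP n z) => [//|i zi|-> //].
  by rewrite zi spin_sec_y; exact: Gam_at_y.
apply: (sub_mulr (Gam_subgroup n) hc).
suff -> : at_ (o n) (spinp n.+1 b) ** c = spinp n b by exact: Gam_spin.
have rc : rt c = gone by [].
apply: port_eq => [|z]; first by rewrite rt_hom rt_at rc gmul1.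
rewrite (sec_mul0 _ _ rc) sec_spin sec_at sc.
by case: eqP => [->|_]; rewrite ?gmul1 // spin_sec_o gmul1r.
Qed.

(** Together with [Gam_sec] this identifies the stabilizer of the first level in [Gam n] with the
    full product of copies of [Gam n.+1]. *)
Lemma Gam_at n x a : x < m n -> Gam n.+1 a -> Gam n (at_ x a).
Proof.
move=> hx; apply: (gen_hom (at_hom x) (Gam_subgroup n)) => _ [[i [b ->]]|[b ->]].
  by apply: Gam_at_rooted => //; exact: Rt_rho.
exact: Gam_at_spin.
Qed.

(** The shift [n] of the level makes validity recursive along the word; [valid_wordE] relates it to
    [valid_word]. *)
Fixpoint valid n v := if v is x :: w then (x < m n) && valid n.+1 w else true.

Lemma valid_wordE n v : all (fun i => nth 0 v i < m (n + i)) (iota 0 (size v)) = valid n v.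
Proof.
elim: v n => //= x v IH n; rewrite addn0; congr andb.
rewrite -IH (iotaDl 1 0) all_map; apply: eq_all => i /=.
by rewrite addnA addn1.
Qed.

Lemma Gam_atw n v a : valid n v -> Gam (n + size v) a -> Gam n (atw v a).
Proof.
elim: v n => [|x v IH] n /=; first by rewrite addn0.
by move=> /andP[hx hv] ha; apply: Gam_at => //; apply: IH; rewrite ?addSnnS.
Qed.

Lemma act_valid n a v : Gam n a -> valid n v -> valid n (act a v).
Proof.
elim: v n a => // x v IH n a ha /= /andP[hx hv].
by rewrite Gam_root_lt // IH //; exact: Gam_sec.
Qed.

Lemma Gam_faithful n a : Gam n a -> (forall v, valid n v -> act a v = v) -> a = gone.
Proof.
move=> ha hv; apply: functional_extensionality => w; elim: w n a ha hv => [|x w IH] n a ha hv.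
  apply: bij_ext => x; have [r _ _] := Gam_tame ha.
  case: (ltnP x (m n)) => hx; last by rewrite [LHS]r.
  by have := hv [:: x]; rewrite /= hx => /(_ isT) [->].
have [_ _ so] := Gam_tame ha.
case: (ltnP x (m n)) => hx; last exact: (congr1 (fun c : port => c w) (so _ hx)).
apply: (IH n.+1 (sec a x)); first exact: Gam_sec.
by move=> v hvv; have := hv (x :: v); rewrite /= hx hvv => /(_ isT) [_ ->].
Qed.

(** A rooted element adjusts the first letter; an element placed below the new letter adjusts the
    rest. *)
Lemma Gam_trans n u v : size u = size v -> valid n u -> valid n v -> exists2 a, Gam n a & act a u = v.
Proof.
elim: u v n => [|x u IH] [|z v] n //=; first by exists (gone : port); first exact: sub1 (Gam_subgroup n).
move=> [huv] /andP[hx hu] /andP[hz hv].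
have [s hs sx] := Rt_trans hx hz; have [a ha au] := IH _ _ huv hu hv.
exists (at_ z a ** rooted s).
  by apply: subM (Gam_subgroup n) _ _; [exact: Gam_at|exact: Gam_rooted].
congr cons; first exact: sx.
rewrite -[LHS]/(act (sec (at_ z a ** rooted s) x) u) sec_mul rt_rooted sx sec_at eqxx.
by rewrite sec_rooted gmul1r au.
Qed.

Definition stab_gens n l : port -> Prop :=
  fun a => exists v d, [/\ size v = l, valid n v, Gam (n + l) d & a = atw v d].

Lemma valid_nseq0 n l : valid n (nseq l 0).
Proof. by elim: l n => //= l IH n; rewrite IH andbT (leq_trans _ (m2 n)). Qed.

Lemma Gam_stab n l a : Gam n a -> (forall v, size v = l -> valid n v -> act a v = v) ->
  gen (stab_gens n l) a.
Proof.
elim: l n a => [|l IH] n a ha hv.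
  by apply: gen_in; exists [::], a; rewrite addn0.
have [r _ so] := Gam_tame ha.
apply: (@sec_split_mem _ (gen_is_subgroup _) (m n)) => //.
  apply: bij_ext => x; case: (ltnP x (m n)) => hx; last exact: r.
  (* Only words of full length are known to be fixed, so the letter [x] is padded by zeros. *)
  by have := hv (x :: nseq l 0); rewrite /= size_nseq hx valid_nseq0 => /(_ erefl isT) [->].
move=> x hx; suff : gen (stab_gens n.+1 l) (sec a x).
  apply: (gen_hom (at_hom x) (gen_is_subgroup _)) => _ [v [d [sv vv hd ->]]].
  by apply: gen_in; exists (x :: v), d; rewrite /= sv hx vv -addSnnS.
apply: IH => [|v sv vv]; first exact: Gam_sec.
by have := hv (x :: v); rewrite /= sv hx vv => /(_ erefl isT) [_ ->].
Qed.

Definition GamG : grp := subgrp (Gam_subgroup 0).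

Lemma valid_vertex (v : vertex m) : valid 0 (proj1_sig v).
Proof. by rewrite -valid_wordE; exact: (proj2_sig v). Qed.

Lemma vertex_valid v : valid 0 v -> valid_word m v.
Proof. by rewrite -valid_wordE. Qed.

Definition tact (g : GamG) (v : vertex m) : vertex m :=
  exist _ (act (proj1_sig g) (proj1_sig v))
    (vertex_valid (act_valid (proj2_sig g) (valid_vertex v))).

Lemma act_prefix (a : port) u v : is_prefix u v -> is_prefix (act a u) (act a v).
Proof.
rewrite /is_prefix => /eqP e; rewrite -(cat_take_drop (size u) v) act_cat.
by rewrite take_size_cat ?size_act e.
Qed.

Lemma tact_tree : tree_action tact.
Proof.
split.
- by move=> v; apply: sig_inj; exact: act_one.
- by move=> g h v; apply: sig_inj; exact: act_mul.
- by move=> g u v; rewrite /adjacent /= !size_act => -[] [-> p]; [left|right]; split=> //; exact: act_prefix.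
- by move=> g; apply: sig_inj.
Qed.

Lemma tact_faithful : faithful_action tact.
Proof.
move=> g hg; apply: sig_inj; apply: (Gam_faithful (proj2_sig g)) => v hv.
exact: (congr1 (@proj1_sig _ _) (hg (exist _ v (vertex_valid hv)))).
Qed.

Lemma tact_trans : level_transitive tact.
Proof.
move=> u v e; have [a ha au] := Gam_trans e (valid_vertex u) (valid_vertex v).
by exists (exist _ a ha); apply: sig_inj.
Qed.

Lemma act_bounded n (K : nat) (a : port) w : Gam n a -> (forall i, i < size w -> m (n + i) <= K) ->
  valid n w -> all (fun x => x < K) (act a w).
Proof.
move=> ha hK hw; have {hw} := act_valid ha hw.
rewrite -(size_act a w) in hK; elim: (act a w) n {ha} hK => //= x v IH n hK /andP[hx hv].
apply/andP; split; first by apply: leq_trans hx _; move: (hK 0); rewrite addn0; exact.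
by apply: IH hv => i hi; rewrite addSnnS; exact: hK.
Qed.

(** Elements with the same action on level [l] differ by an element of the level stabilizer, and by
    [Gam_stab] this stabilizer is generated by rigid elements. *)
Lemma rist_finite_index l : finite_index (rist_level tact l).
Proof.
(* All letters on the first [l] levels are below [K], so vertices of level [l] become tuples over a
   finite type; the successor makes [inord] available. *)
pose K := (\max_(i < l) m i).+1.
have hK i : i < l -> m i <= K.-1.
  by move=> hi; exact: (leq_bigmax (F := fun i : 'I_l => m i) (Ordinal hi)).
pose F (g : GamG) : {ffun l.-tuple 'I_K -> l.-tuple 'I_K} :=
  [ffun t : l.-tuple 'I_K => [tuple inord (nth 0 (act (proj1_sig g) (map val t)) i) | i < l]].
apply: (@finite_index_by _ _ _ F) => g h e.
have eqact v : size v = l -> valid 0 v -> act (proj1_sig g) v = act (proj1_sig h) v.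
  move=> sv hv.
  have bd a : Gam 0 a -> all (fun x => x < K) (act a v).
    move=> ha; apply: act_bounded ha _ hv => i; rewrite sv add0n => hi.
    exact: leq_trans (hK _ hi) (leqnSn _).
  have bv : all (fun x => x < K) v by have := bd _ (sub1 (Gam_subgroup 0)); rewrite act_one.
  have ht : size (map (@inord K.-1) v) == l by rewrite size_map sv.
  pose t : l.-tuple 'I_K := Tuple ht.
  have tv : map val t = v.
    by rewrite /= -map_comp -[RHS]map_id; apply/eq_in_map => x /(allP bv) hx /=; rewrite inordK.
  have := congr1 (fun f : {ffun l.-tuple 'I_K -> l.-tuple 'I_K} => f t) e; rewrite !ffunE tv => et.
  apply: (@eq_from_nth _ 0); rewrite !size_act // sv => i hi.
  have := congr1 (fun s => val (tnth s (Ordinal hi))) et; rewrite !tnth_mktuple /=.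
  by rewrite !inordK //; apply: (all_nthP 0 (bd _ _)); rewrite ?size_act ?sv //; exact: proj2_sig.
have : gen (stab_gens 0 l) (proj1_sig (ginv g ** h)).
  apply: Gam_stab => [|v sv hv]; first exact: proj2_sig.
  by apply: (@act_inj (proj1_sig g)); rewrite -act_mul /= gmulK eqact.
apply: gen_lift => _ [v [d [sv hv hd ->]]].
have ha : Gam 0 (atw v d) by apply: Gam_atw; rewrite ?sv.
exists ha; apply: gen_in; exists (exist _ v (vertex_valid hv)); split=> // w hw.
by apply: sig_inj; exact: act_atw.
Qed.

Lemma GamG_branch : branch_group GamG.
Proof.
exists m, tact; split; [exact: m2|exact: tact_tree|exact: tact_faithful|exact: tact_trans|].
exact: rist_finite_index.
Qed.

(** Every generator lies in a homomorphic image of the perfect group [B]. *)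
Lemma GamG_perfect : perfect GamG.
Proof.
apply: perfect_subgrp; apply: (@gen_sub port (gens 0)) => _ [[i [b ->]]|[b ->]].
  have h : is_hom (fun c => rooted (rho i c)) by move=> c d; rewrite rho_hom rooted_hom.
  have := B_perfect b; apply: (gen_hom h (gen_is_subgroup _)) => _ [c [d ->]].
  rewrite (hom_comm h); apply: gen_in.
  by exists (rooted (rho i c)), (rooted (rho i d)); split=> //; apply: Gam_rooted; exact: Rt_rho.
have := B_perfect b; apply: (gen_hom (@spinp_hom 0) (gen_is_subgroup _)) => _ [c [d ->]].
rewrite (hom_comm (@spinp_hom 0)); apply: gen_in.
by exists (spinp 0 c), (spinp 0 d); split=> //; exact: Gam_spin.
Qed.

End Branching.

Lemma GamG_fg : finitely_generated B -> finitely_generated GamG.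
Proof.
case=> k [g hg].
pose s := map (fun j => spinp 0 (g j)) (enum 'I_k) ++
  map (fun ij : I 0 * 'I_k => rooted (rho ij.1 (g ij.2))) (enum {: I 0 * 'I_k}).
apply: (@fg_subgrp _ _ _ s) => [x hx|].
  case: (List.in_app_or _ _ _ hx) => hx'; have [z ->] := map_In hx'.
    exact: Gam_spin.
  by apply: Gam_rooted; exact: Rt_rho.
apply: (@gen_sub port (gens 0)) => _ [[i [b ->]]|[b ->]].
  have h : is_hom (fun c => rooted (rho i c)) by move=> c d; rewrite rho_hom rooted_hom.
  have := hg b; apply: (gen_hom h (gen_is_subgroup _)) => _ [j ->].
  apply: gen_in; apply: List.in_or_app; right.
  by apply: (@In_map _ _ (fun ij : I 0 * 'I_k => rooted (rho ij.1 (g ij.2))) _ (i, j)); rewrite mem_enum.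
have := hg b; apply: (gen_hom (@spinp_hom 0) (gen_is_subgroup _)) => _ [j ->].
apply: gen_in; apply: List.in_or_app; left.
by apply: (@In_map _ _ (fun j => spinp 0 (g j))); rewrite mem_enum.
Qed.

Section Faithful.
Hypothesis faithful : forall N b,
  (forall n (i : I n.+1), N <= n -> rho i b = gone) -> b = gone.

(** Triviality propagates along the ray to all [spinp n b] with [N <= n], hence to the rooted
    sections hanging beside it. Any starting level [N] is allowed, because powers are compared with
    [B] deep in the tree. *)
Lemma spinp_eq1 N b : spinp N b = gone -> b = gone.
Proof.
move=> hb; apply: (faithful (N := N)) => n i hn.
have {hn} h : spinp n b = gone.
  rewrite -(subnKC hn); elim: (n - N) => [|d IH]; first by rewrite addn0.
  by rewrite addnS -(spin_sec_o (N + d)) -sec_spin IH.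
by rewrite -(rt_rooted (rho i b)) -spin_sec_y -sec_spin h.
Qed.

Lemma GamG_embeds : embeds B GamG.
Proof.
exists (fun b => exist _ (spinp 0 b) (@Gam_spin 0 b)); split.
  by move=> b c; apply: sig_inj; exact: spinp_hom.
apply: hom_inj; first by move=> b c; apply: sig_inj; exact: spinp_hom.
by move=> b /(congr1 (@proj1_sig _ _)) /spinp_eq1.
Qed.

End Faithful.

End TreeGroup.

(** * Powers and sections in the tree group *)

Lemma iter_bf_cancel (p : bij nat) i d x : iter (i + d) p x = iter i p x -> iter d p x = x.
Proof. by elim: i => // i IH h; apply: IH; exact: bf_inj h. Qed.

(** By pigeonhole the point returns. Up to the first return the orbit has no repetition, since a
    coincidence would cancel to an earlier return. *)
Lemma orbit_period (M : nat) (p : bij nat) x : (forall z, M <= z -> p z = z) -> x < M ->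
  exists l, [/\ 0 < l, iter l p x = x & uniq (traject p x l)].
Proof.
move=> hp hx.
have not_uniq l : ~~ uniq (traject p x l) -> exists2 d, 0 < d < l & iter d p x = x.
  case/(uniqPn x) => i [j []]; rewrite size_traject => ij jl; rewrite !nth_traject ?(ltn_trans ij) //.
  move=> e; exists (j - i); first by rewrite subn_gt0 ij (leq_ltn_trans (leq_subr _ _)).
  by apply: (@iter_bf_cancel p i); rewrite subnKC // ltnW.
have ex : exists l, (0 < l) && (iter l p x == x).
  have [|d /andP[d0 _] hd] := @not_uniq M.+1; last by exists d; rewrite d0 hd eqxx.
  apply/negP => hu; have := @uniq_leq_size _ (traject p x M.+1) (iota 0 M) hu.
  rewrite size_traject size_iota ltnn => h; suff : false by []; apply: h => z.
  case/trajectP => i _ ->; rewrite mem_iota add0n /=.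
  by elim: i => //= i IH; exact: fix_lt.
case: (ex_minnP ex) => l /andP[l0 /eqP hl] hmin; exists l; split=> //.
apply/negPn/negP => /not_uniq[d /andP[d0 dl] hd].
by have := hmin d; rewrite d0 hd eqxx => /(_ isT); rewrite leqNgt dl.
Qed.

Lemma iter_mul_fix (p : nat -> nat) l q x : iter l p x = x -> iter (q * l) p x = x.
Proof. by move=> h; elim: q => // q IH; rewrite mulSn iterD IH. Qed.

Lemma perm_finite_order (M : nat) (s : permgrp nat) :
  (forall z, M <= z -> (s : bij nat) z = z) -> exists2 e, 0 < e & gpow s e = gone.
Proof.
move=> hs.
have per x : {l | x < M -> 0 < l /\ iter l (s : bij nat) x = x}.
  apply: constructive_indefinite_description; case: (ltnP x M) => hx; last by exists 0.
  by have [l [l0 hl _]] := orbit_period hs hx; exists l.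
pose l x := proj1_sig (per x).
have hl x : x < M -> 0 < l x /\ iter (l x) (s : bij nat) x = x := proj2_sig (per x).
exists (\prod_(x < M) l x).
  by apply: prodn_gt0 => x; have [] := hl x (ltn_ord x).
apply: bij_ext => x; rewrite bpowE boneE.
case: (ltnP x M) => hx; last by elim: (\prod_(_ < _) _) => //= k ->; exact: hs.
rewrite (bigD1 (Ordinal hx)) //= mulnC; apply: iter_mul_fix.
by have [] := hl x hx.
Qed.

Lemma sec_pow0 (a : port) q x : (rt a : bij nat) x = x -> sec (gpow a q) x = gpow (sec a x) q.
Proof.
move=> h; elim: q => //= q IH.
by rewrite sec_mul IH (hom_pow rt_hom) bpowE; congr (@gmul port (sec a _) _); elim: q {IH} => //= q ->.
Qed.

(** * Counting letters in sections of powers *)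

Section LocalPowers.
Variables (B : grp) (m : nat -> nat) (I : nat -> finType).
Variables (rho : forall n, I n -> B -> permgrp nat) (o : nat -> nat) (y : forall n, I n.+1 -> nat).

Hypothesis m2 : forall n, 2 <= m n.
Hypothesis rho_hom : forall n (i : I n), is_hom (@rho n i).
Hypothesis rho_out : forall n (i : I n) b x, m n <= x -> (rho i b : bij nat) x = x.
Hypothesis o_lt : forall n, o n < m n.
Hypothesis y_lt : forall n (i : I n.+1), y i < m n.
Hypothesis y_neq_o : forall n (i : I n.+1), y i != o n.
Hypothesis y_inj : forall n, injective (@y n).

Local Notation spinp := (spinp rho o y).
Local Notation Gam := (Gam rho o y).

(** Words are kept as syntax because the numbers of directed and rooted letters are not determined
    by the group element. *)
Definition letter n := ((I n * B) + B)%type.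
Definition word n := seq (letter n).

Definition ev_letter n (g : letter n) : port :=
  match g with inl ib => rooted (rho ib.1 ib.2) | inr b => spinp n b end.
Definition ev n (w : word n) : port := foldr (fun g a => ev_letter g ** a) gone w.

Definition is_spin n (g : letter n) := if g is inr _ then true else false.
Definition nspin n (w : word n) := count (@is_spin n) w.
Definition nroot n (w : word n) := count (predC (@is_spin n)) w.

Lemma ev_cat n (u w : word n) : ev (u ++ w) = ev u ** ev w.
Proof. by elim: u => [|g u IH] /=; rewrite ?gmul1 // IH gmulA. Qed.

Definition inv_letter n (g : letter n) : letter n :=
  match g with inl ib => inl (ib.1, ginv ib.2) | inr b => inr (ginv b) end.

Lemma ev_inv n (w : word n) : ev (rev (map (@inv_letter n) w)) = ginv (ev w).
Proof.
elim: w => [|g w IH] /=; first by rewrite ginv1.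
rewrite rev_cons -cats1 ev_cat IH ginvM; congr (@gmul port _ _); rewrite /ev /= gmul1r.
case: g => [[i b]|b] /=; first by rewrite (homV (rho_hom i)) (homV rooted_hom).
by rewrite (homV (@spinp_hom _ _ _ o y rho_hom n)).
Qed.

Lemma Gam_word n a : Gam n a -> exists w : word n, a = ev w.
Proof.
apply: (@gen_min port (gens rho o y n) (fun a => exists w : word n, a = ev w)).
  split; first by exists [::].
  - by move=> _ _ [u ->] [w ->]; exists (u ++ w); rewrite ev_cat.
  - by move=> _ [w ->]; exists (rev (map (@inv_letter n) w)); rewrite ev_inv.
move=> _ [[i [b ->]]|[b ->]]; [exists [:: inl (i, b)]|exists [:: inr b]];
  by rewrite /ev /= gmul1r.
Qed.

Lemma ev_Gam n (w : word n) : Gam n (ev w).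
Proof.
elim: w => [|g w IH] /=; first exact: sub1 (Gam_subgroup rho o y n).
apply: subM (Gam_subgroup rho o y n) _ IH.
by apply: gen_in; case: g => [[i b]|b]; [left; exists i, b|right; exists b].
Qed.

Definition sec_letter n (g : letter n) (z : nat) : word n.+1 :=
  match g with
  | inl _ => [::]
  | inr b => if z == o n then [:: inr b]
             else if [pick i | @y n i == z] is Some i then [:: inl (i, b)] else [::]
  end.

(** In the section of a product at [x], each letter is read at the image of [x] under the letters to
    its right. *)
Fixpoint secw n (w : word n) (x : nat) : word n.+1 :=
  if w is g :: w' then sec_letter g ((rt (ev w') : bij nat) x) ++ secw w' x else [::].

Lemma ev_secw n (w : word n) x : ev (secw w x) = sec (ev w) x.
Proof.
elim: w => //= g w IH; rewrite ev_cat IH sec_mul; congr (@gmul port _ _).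
case: g => [[i b]|b] //=; rewrite (sec_spin rho o y n b) /spin_sec.
by case: eqP => _ /=; rewrite ?gmul1r //; case: pickP => [i _|_] //=; rewrite gmul1r.
Qed.

Lemma nspin_cat n (u w : word n) : nspin (u ++ w) = nspin u + nspin w.
Proof. exact: count_cat. Qed.
Lemma nroot_cat n (u w : word n) : nroot (u ++ w) = nroot u + nroot w.
Proof. exact: count_cat. Qed.

Lemma sum_count (xs : seq nat) z : uniq xs -> \sum_(x <- xs) (x == z) <= 1.
Proof.
move=> hu; rewrite -big_mkcond sum1_count; have := count_uniq_mem z hu.
by rewrite /= => ->; exact: leq_b1.
Qed.

(** Each directed letter is read at the images of the distinct points [xs] under one permutation, so
    it meets [o n] at most once. *)
Lemma sum_nspin n (w : word n) xs : uniq xs -> \sum_(x <- xs) nspin (secw w x) <= nspin w.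
Proof.
move=> hu; elim: w => [|g w IH] /=; first by rewrite big1.
under eq_bigr => x _ do rewrite nspin_cat.
rewrite big_split /=; apply: leq_add; last exact: IH.
rewrite -(big_map (rt (ev w) : bij nat) xpredT (fun z => nspin (sec_letter g z))).
have {hu} := hu; rewrite -(map_inj_uniq (@bf_inj _ (rt (ev w)))).
move: (map _ _) => zs hz; case: g => [ib|b] /=; first by rewrite big1.
apply: leq_trans (sum_count (o n) hz); apply: leq_sum => z _.
by case: eqP => // _; case: pickP.
Qed.

(** Similarly each directed letter meets each [y i] at most once, whence the factor [#|I n.+1|]. *)
Lemma sum_nroot n (w : word n) xs : uniq xs ->
  \sum_(x <- xs) nroot (secw w x) <= nspin w * #|I n.+1|.
Proof.
move=> hu; elim: w => [|g w IH] /=; first by rewrite big1.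
under eq_bigr => x _ do rewrite nroot_cat.
rewrite big_split mulnDl /=; apply: leq_add; last exact: IH.
rewrite -(big_map (rt (ev w) : bij nat) xpredT (fun z => nroot (sec_letter g z))).
have {hu} := hu; rewrite -(map_inj_uniq (@bf_inj _ (rt (ev w)))).
move: (map _ _) => zs hz; case: g => [ib|b] /=; first by rewrite big1.
rewrite mul1n; apply: (@leq_trans (\sum_(z <- zs) \sum_(i : I n.+1) (z == y i))).
  apply: leq_sum => z _; case: eqP => // _; case: pickP => // i /eqP iz.
  by rewrite (bigD1 i) //= iz eqxx.
rewrite exchange_big /= -sum1_card; apply: leq_sum => i _; exact: sum_count.
Qed.

Fixpoint orbw n (w : word n) (x : nat) (l : nat) : word n.+1 :=
  if l is l'.+1 then secw w (iter l' (rt (ev w) : bij nat) x) ++ orbw w x l' else [::].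

Lemma ev_orbw n (w : word n) x l : ev (orbw w x l) = sec (gpow (ev w) l) x.
Proof.
elim: l => //= l IH.
by rewrite ev_cat ev_secw IH sec_mul (hom_pow rt_hom) bpowE.
Qed.

Lemma nspin_orbw n (w : word n) x l : uniq (traject (rt (ev w) : bij nat) x l) ->
  nspin (orbw w x l) <= nspin w.
Proof.
move=> hu; apply: leq_trans (sum_nspin w hu); elim: l {hu} => //= l IH.
by rewrite -/(traject _ x l.+1) trajectSr big_rcons /= nspin_cat addnC leq_add2r.
Qed.

Lemma nroot_orbw n (w : word n) x l : uniq (traject (rt (ev w) : bij nat) x l) ->
  nroot (orbw w x l) <= nspin w * #|I n.+1|.
Proof.
move=> hu; apply: leq_trans (sum_nroot w hu); elim: l {hu} => //= l IH.
by rewrite -/(traject _ x l.+1) trajectSr big_rcons /= nroot_cat addnC leq_add2r.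
Qed.

Definition ev_root n (u : seq (I n * B)) : permgrp nat :=
  foldr (fun ib s => rho ib.1 ib.2 ** s) gone u.

(** Directed letters fix the first level, so only rooted letters contribute to the root
    permutation. *)
Lemma rt_ev n (w : word n) : exists2 u : seq (I n * B), size u = nroot w & rt (ev w) = ev_root u.
Proof.
elim: w => [|[[i b]|b] w [u su eu]] /=; first by exists [::].
  by exists ((i, b) :: u); rewrite /= ?su ?rt_hom ?rt_rooted ?eu.
by exists u; rewrite ?rt_hom ?rt_spin ?gmul1.
Qed.

Section ClassC.
Variable C : grp -> Prop.
Hypothesis Ciso : group_class C.
Hypothesis Csub : subgroup_closed C.
Hypothesis Cprod : dirprod_closed C.

(** A power of [a i] divisible by all return times fixes the first level, and its section at [x] is
    a power of the section at first return. The generated group thus embeds into the product over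
    [x] of groups provided by the hypothesis. *)
Lemma powC_sections n k (a : 'I_k -> port) (l : 'I_k -> nat -> nat) :
  (forall i, Gam n (a i)) ->
  (forall i x, x < m n -> 0 < l i x /\ iter (l i x) (rt (a i) : bij nat) x = x) ->
  (forall x, x < m n -> powC C (fun i => sec (gpow (a i) (l i x)) x)) ->
  powC C a.
Proof.
move=> ha hl hC.
have ht x : {t : 'I_k -> nat | x < m n -> (forall i, 0 < t i) /\
    C (gen_grp (fun z => exists i, z = gpow (sec (gpow (a i) (l i x)) x) (t i)))}.
  apply: constructive_indefinite_description; case: (ltnP x (m n)) => hx.
    by have [t ht] := hC x hx; exists t.
  by exists (fun=> 0).
pose t x := proj1_sig (ht x).
have tP x : x < m n -> (forall i, 0 < t x i) /\
    C (gen_grp (fun z => exists i, z = gpow (sec (gpow (a i) (l i x)) x) (t x i))).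
  exact: proj2_sig (ht x).
(* One exponent serves all points [x] at once: it is divisible by every [l i x * t x i]. *)
pose T i := \prod_(x < m n) (l i x * t x i).
have dvdT i x : x < m n -> exists q, T i = l i x * (t x i * q).
  move=> hx; rewrite /T (bigD1 (Ordinal hx)) //=.
  by exists (\prod_(j < m n | j != Ordinal hx) (l i j * t j i)); rewrite mulnA.
exists T; split=> [i|].
  apply: prodn_gt0 => x; rewrite muln_gt0.
  by have [-> _] := hl i x (ltn_ord x); have [-> _] := tP x (ltn_ord x).
pose S : port -> Prop := gen (fun z => exists i, z = gpow (a i) (T i)).
have m0 : 0 < m n := leq_trans (isT : 0 < 2) (m2 n).
pose V x : port -> Prop :=
  gen (fun z => exists i, z = gpow (sec (gpow (a i) (l i x)) x) (t x i)).
pose St (b : port) := rt b = gone /\ forall x, m n <= x -> sec b x = gone.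
have hSt : is_subgroup St.
  split=> [//|b c [rb sb] [rc sc]|b [rb sb]]; split.
  - by rewrite rt_hom rb rc gmul1.
  - by move=> x hx; rewrite sec_mul0 // sb // sc // gmul1.
  - by rewrite (homV rt_hom) rb ginv1.
  - by move=> x hx; rewrite sec_inv0 // sb // ginv1.
have hout i x : m n <= x -> (rt (a i) : bij nat) x = x.
  by have [h _ _] := Gam_tame rho_out o_lt y_lt y_neq_o y_inj (ha i); exact: h.
have rT i : rt (gpow (a i) (T i)) = gone.
  rewrite (hom_pow rt_hom); apply: bij_ext => x; rewrite bpowE boneE.
  case: (ltnP x (m n)) => hx; last by elim: (T i) => //= d ->; exact: hout.
  have [q ->] := dvdT i x hx; rewrite mulnC; apply: iter_mul_fix.
  by have [] := hl i x hx.
have ST b : S b -> St b.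
  apply: gen_min => // _ [i ->]; split=> // x hx.
  have hG : Gam n (gpow (a i) (T i)) by apply: sub_pow (Gam_subgroup rho o y n) _.
  by have [_ _ h] := Gam_tame rho_out o_lt y_lt y_neq_o y_inj hG; exact: h.
have SV x : x < m n -> forall b, S b -> St b /\ V x (sec b x).
  move=> hx; have hV : is_subgroup (V x) by exact: gen_is_subgroup.
  apply: gen_min.
    split; first by split; [exact: (sub1 hSt)|rewrite sec1; exact: (sub1 hV)].
    - move=> b c [hb vb] [hc vc]; split; first exact: (subM hSt).
      by rewrite sec_mul0; [exact: (subM hV)|case: hc].
    - move=> b [hb vb]; split; first exact: (subV hSt).
      by rewrite sec_inv0; [exact: (subV hV)|case: hb].
  move=> _ [i ->]; split; first by apply: ST; apply: gen_in; exists i.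
  have [q ->] := dvdT i x hx; rewrite gpowM sec_pow0; last first.
    by rewrite (hom_pow rt_hom) bpowE; have [] := hl i x hx.
  by rewrite gpowM; apply: (sub_pow _ hV); apply: gen_in; exists i.
apply: (@C_family _ Ciso Csub Cprod _ port port (iota 0 (m n)) S _ V (fun x b => sec b x)).
- by have [_ h] := tP 0 m0; exists (gen_grp (fun z => exists i, z = gpow (sec (gpow (a i) (l i 0)) 0) (t 0 i))).
- by move=> x; exact: gen_is_subgroup.
- move=> x hV; rewrite mem_iota add0n /= => hx; have [_ h] := tP x hx.
  by rewrite (proof_irrelevance _ hV (gen_is_subgroup _)).
- by move=> x b; rewrite mem_iota add0n /= => hx hb; have [] := SV x hx b hb.
- by move=> x b c hb hc; rewrite sec_mul0 //; have [] := ST c hc.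
- move=> b hb h; have [rb sb] := ST b hb; apply: port_eq => // x.
  by case: (ltnP x (m n)) => hx; [apply: h; rewrite mem_iota|exact: sb].
Qed.

Hypothesis B_powC : locally_up_to_powers C B.
Hypothesis faithful : forall N b,
  (forall n (i : I n.+1), N <= n -> rho i b = gone) -> b = gone.

(** Raising entries of finite order to that order makes them trivial, and then all entries lie in
    one copy [spinp N] of [B], faithful by [spinp_eq1]. There the property of [B] applies. *)
Lemma powC_base N k (a : 'I_k -> port) :
  (forall i, (exists b, a i = spinp N b) \/
             exists s e, [/\ 0 < e, gpow s e = gone & a i = rooted s]) ->
  powC C a.
Proof.
move=> ha.
have hc i : {be : B * nat | 0 < be.2 /\ gpow (a i) be.2 = spinp N (gpow be.1 be.2)}.
  apply: constructive_indefinite_description; have [[b ->]|[s [e [e0 he ->]]]] := ha i.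
    by exists (b, 1); split=> //=; rewrite !gmul1r.
  exists (gone, e); split=> //=.
  rewrite gpow_one -(hom_pow rooted_hom) he (hom1 rooted_hom).
  by rewrite (hom1 (@spinp_hom _ _ _ o y rho_hom N)).
pose b i := (proj1_sig (hc i)).1; pose e i := (proj1_sig (hc i)).2.
have {ha} be i : 0 < e i /\ gpow (a i) (e i) = spinp N (gpow (b i) (e i)) := proj2_sig (hc i).
have [t [t0 ht]] := B_powC b.
exists (fun i => e i * t i); split=> [i|].
  by rewrite muln_gt0 t0; have [->] := be i.
have hS := gen_is_subgroup (fun z => exists i, z = gpow (b i) (t i)).
pose S' a' := exists2 c, gen (fun z => exists i, z = gpow (b i) (t i)) c & a' = spinp N c.
have hom := @spinp_hom _ _ _ o y rho_hom N.
have hS' : is_subgroup S'.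
  split; first by exists gone; [exact: (sub1 hS)|rewrite (hom1 hom)].
  - by move=> _ _ [c hc' ->] [d hd ->]; exists (c ** d); [exact: (subM hS)|rewrite hom].
  - by move=> _ [c hc' ->]; exists (ginv c); [exact: (subV hS)|rewrite (homV hom)].
have CS' : C (subgrp hS').
  have ex (x : subgrp hS') : {c | gen (fun z => exists i, z = gpow (b i) (t i)) c /\
      proj1_sig x = spinp N c}.
    apply: constructive_indefinite_description.
    by case: (proj2_sig x) => c h1 h2; exists c.
  have inj : injective (spinp N).
    by apply: (hom_inj hom) => c; exact: (spinp_eq1 y_neq_o y_inj faithful).
  apply: (C_embeds Ciso Csub _ ht).
  exists (fun x => exist _ (proj1_sig (ex x)) (proj1 (proj2_sig (ex x)))); split.
    move=> x z; apply: sig_inj; apply: inj => /=; rewrite hom.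
    rewrite -(proj2 (proj2_sig (ex x))) -(proj2 (proj2_sig (ex z))).
    by rewrite -(proj2 (proj2_sig (ex (x ** z)))).
  move=> x z /(congr1 (@proj1_sig _ _)) /= h; apply: sig_inj.
  by rewrite (proj2 (proj2_sig (ex x))) (proj2 (proj2_sig (ex z))) h.
apply: (@C_sub _ Ciso Csub _ _ _ S' _ hS' id) CS' => //.
apply: gen_min => // _ [i ->].
exists (gpow (gpow (b i) (e i)) (t i)).
  by rewrite -gpowM mulnC gpowM; apply: (sub_pow _ hS); apply: gen_in; exists i.
by rewrite gpowM; have [_ ->] := be i; rewrite !(hom_pow hom).
Qed.

(** If an orbit of the word [v] is read at [o n] after the suffix [w] and at [y i] after the suffix
    [u], then an element of this form carries [o n] to [y i]. Excluding it keeps directed and rooted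
    letters in different orbits. *)
Hypothesis avoid : forall n (u v w : seq (I n * B)) t i,
  size u <= n * #|I n| -> size v <= n * #|I n| -> size w <= n * #|I n| ->
  ((ev_root u ** gpow (ev_root v) t ** ginv (ev_root w) : permgrp nat) : bij nat) (o n) <> @y n i.

(** The witness [u] is the suffix to the right of the letter that produced the directed section;
    [secw_root] is the analogue for rooted sections. *)
Lemma secw_spin n (w : word n) x : has (@is_spin _) (secw w x) ->
  exists2 u : word n, nroot u <= nroot w & (rt (ev u) : bij nat) x = o n.
Proof.
elim: w => //= g w IH; rewrite has_cat => /orP[|/IH[u hu eu]]; last first.
  by exists u => //; rewrite /nroot /=; exact: leq_trans hu (leq_addl _ _).
move=> h; exists w; first by rewrite /nroot /= leq_addl.
by case: g h => //= b; case: eqP => // _; case: pickP.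
Qed.

Lemma secw_root n (w : word n) x : has (predC (@is_spin _)) (secw w x) ->
  exists2 u : word n, nroot u <= nroot w & exists i : I n.+1, (rt (ev u) : bij nat) x = y i.
Proof.
elim: w => //= g w IH; rewrite has_cat => /orP[|/IH[u hu eu]]; last first.
  by exists u => //; rewrite /nroot /=; exact: leq_trans hu (leq_addl _ _).
move=> h; exists w; first by rewrite /nroot /= leq_addl.
by case: g h => //= b; case: eqP => // _; case: pickP => // i /eqP <- _; exists i.
Qed.

Lemma orbw_has n (w : word n) x l (P : pred (letter n.+1)) : has P (orbw w x l) ->
  exists2 t, t < l & has P (secw w (iter t (rt (ev w) : bij nat) x)).
Proof.
elim: l => //= l IH; rewrite has_cat => /orP[h|/IH[t ht h]]; first by exists l.
by exists t => //; exact: leqW.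
Qed.

Lemma orbw_pure n (w : word n) x l :
  nroot w <= n * #|I n| -> iter l (rt (ev w) : bij nat) x = x ->
  ~~ (has (@is_spin _) (orbw w x l) && has (predC (@is_spin _)) (orbw w x l)).
Proof.
move=> hw hl; apply/negP => /andP[/orbw_has[t1 ht1 /secw_spin[u1 hu1 e1]]].
move=> /orbw_has[t2 ht2 /secw_root[u2 hu2 [i e2]]].
have [v2 s2 r2] := rt_ev u2; have [v s r] := rt_ev w; have [v1 s1 r1] := rt_ev u1.
(* To avoid a negative exponent, the passage from time [t1] to time [t2] first completes the orbit
   of length [l]. *)
apply: (@avoid n v2 v v1 (t2 + (l - t1)) i); rewrite ?s2 ?s ?s1 ?(leq_trans hu1) ?(leq_trans hu2) //.
rewrite -r2 -r -r1 !bmulE bpowE binvE -e1 bfK -e2.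
by rewrite -iterD -addnA subnK ?(ltnW ht1) // iterD hl.
Qed.

Lemma ev_all_spin n (w : word n) : ~~ has (predC (@is_spin _)) w -> exists b, ev w = spinp n b.
Proof.
have hom := @spinp_hom _ _ _ o y rho_hom n.
elim: w => [_|[ib|b] w IH] //=; first by exists gone; rewrite (hom1 hom).
by move=> /IH[c ec]; exists (b ** c); rewrite hom -ec.
Qed.

Lemma ev_all_root n (w : word n) : ~~ has (@is_spin _) w ->
  exists2 s : permgrp nat, (forall z, m n <= z -> (s : bij nat) z = z) & ev w = rooted s.
Proof.
elim: w => [_|[[i b]|b] w IH] //=; first by exists (gone : permgrp nat); rewrite ?(hom1 rooted_hom).
move=> /IH[s hs es]; exists (rho i b ** s); last by rewrite rooted_hom -es.
by move=> z hz; rewrite bmulE hs // rho_out.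
Qed.

(* Induction on the distance [j] to level [s]; only there is the length bound of [avoid] reached. *)
Lemma powC_words s j n k (w : 'I_k -> word n) : 0 < s -> n + j = s ->
  (forall i, nspin (w i) <= s) -> (j = 0 -> forall i, nroot (w i) <= s * #|I n|) ->
  powC C (fun i => ev (w i)).
Proof.
move=> s0; elim: j n w => [|j IH] n w nj hs hr.
all: have per i x : {l | x < m n -> [/\ 0 < l, iter l (rt (ev (w i)) : bij nat) x = x &
    uniq (traject (rt (ev (w i)) : bij nat) x l)]}.
- apply: constructive_indefinite_description; case: (ltnP x (m n)) => hx; last by exists 0.
  have [h _ _] := Gam_tame rho_out o_lt y_lt y_neq_o y_inj (ev_Gam (w i)).
  by have [l hl] := orbit_period h hx; exists l.
- pose l i x := proj1_sig (per i x).
  have hl i x : x < m n -> _ := proj2_sig (per i x).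
  apply: (@powC_sections n _ _ l) => [i|i x hx|x hx]; first exact: ev_Gam.
    by have [] := hl i x hx.
  (* Here [n = s], so the words satisfy the length bound of [avoid]: each section is directed or of
     finite order. *)
  apply: (@powC_base n.+1) => i; rewrite -ev_orbw; have [_ h1 h2] := hl i x hx.
  have hwi : nroot (w i) <= n * #|I n| by move: (hr erefl i); rewrite -nj addn0.
  have := orbw_pure hwi h1.
  rewrite negb_and => /orP[/ev_all_root[r hrt ->]|/ev_all_spin]; last by left.
  by right; have [e e0 he] := perm_finite_order hrt; exists r, e.
- apply: constructive_indefinite_description; case: (ltnP x (m n)) => hx; last by exists 0.
  have [h _ _] := Gam_tame rho_out o_lt y_lt y_neq_o y_inj (ev_Gam (w i)).
  by have [l hl] := orbit_period h hx; exists l.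
- pose l i x := proj1_sig (per i x).
  have hl i x : x < m n -> _ := proj2_sig (per i x).
  apply: (@powC_sections n _ _ l) => [i|i x hx|x hx]; first exact: ev_Gam.
    by have [] := hl i x hx.
  have -> : (fun i => sec (gpow (ev (w i)) (l i x)) x) = (fun i => ev (orbw (w i) x (l i x))).
    by apply: functional_extensionality => i; rewrite ev_orbw.
  apply: IH => [|i|_ i]; first by rewrite addSnnS.
    by have [_ _ h] := hl i x hx; exact: leq_trans (nspin_orbw h) _.
  (* The bound on rooted letters is produced afresh by each descent, so none is required of the
     initial words. *)
  have [_ _ h] := hl i x hx; apply: leq_trans (nroot_orbw h) _.
  by rewrite leq_mul2r hs orbT.
Qed.

Lemma GamG_powC : locally_up_to_powers C (GamG rho o y).
Proof.
move=> k gam.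
have ex i : {w : word 0 | proj1_sig (gam i) = ev w}.
  by apply: constructive_indefinite_description; apply: Gam_word; exact: proj2_sig.
pose w i := proj1_sig (ex i); have hw i : proj1_sig (gam i) = ev (w i) := proj2_sig (ex i).
(* The successor makes [s] positive, so at least one descent takes place and the condition on rooted
   letters is vacuous at the start. *)
pose s := (\max_(i < k) nspin (w i)).+1.
have hs i : nspin (w i) <= s by apply: leqW; exact: leq_bigmax.
have [//|t [t0 ht]] := @powC_words s s 0 k w isT (add0n s) hs.
exists t; split=> //.
pose f (x : GamG rho o y) : port := proj1_sig x.
have hf : is_hom f by [].
apply: (@C_sub C Ciso Csub (GamG rho o y) port _ _ (gen_is_subgroup _) (gen_is_subgroup _) f) ht => //.
  apply: (gen_hom hf (gen_is_subgroup _)) => _ [i ->]; apply: gen_in; exists i.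
  by rewrite -hw; exact: (hom_pow hf).
by move=> x _ h; apply: sig_inj.
Qed.

End ClassC.
End LocalPowers.

(** * Finite actions *)

Section ActionHom.
Variables (G : grp) (T : Type) (f : G -> T -> T).
Hypotheses (f1 : forall x, f gone x = x) (fM : forall a b x, f (gmul a b) x = f a (f b x)).

Lemma action_cancel a : cancel (f a) (f (ginv a)).
Proof. by move=> x; rewrite -fM gmulV f1. Qed.

Lemma action_cancel' a : cancel (f (ginv a)) (f a).
Proof. by move=> x; rewrite -fM gmulVr f1. Qed.

Definition action_perm (a : G) : permgrp T := Bij (action_cancel a) (action_cancel' a).

Lemma action_hom : is_hom action_perm.
Proof. by move=> a b; apply: bij_ext => x; exact: fM. Qed.

End ActionHom.

(** * Coding permutations of a finite type by permutations of [nat] *)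

Section Coding.
Variable X : finType.

Definition enc (x : X) : nat := enum_rank x.

Lemma enc_inj : injective enc.
Proof. by move=> x z /val_inj/enum_rank_inj. Qed.

Lemma enc_lt x : enc x < #|X|.
Proof. exact: ltn_ord. Qed.

Lemma enc_onto k : k < #|X| -> exists x, k = enc x.
Proof. by move=> hk; exists (enum_val (Ordinal hk)); rewrite /enc enum_valK. Qed.

Definition code_fun (f : X -> X) (k : nat) : nat :=
  if insub k : option 'I_#|X| is Some j then enc (f (enum_val j)) else k.

Lemma code_enc f x : code_fun f (enc x) = enc (f x).
Proof. by rewrite /code_fun /enc valK enum_rankK. Qed.

Lemma code_out f k : #|X| <= k -> code_fun f k = k.
Proof. by move=> hk; rewrite /code_fun insubF // ltnNge hk. Qed.

Lemma code_cancel (f g : X -> X) : cancel f g -> cancel (code_fun f) (code_fun g).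
Proof.
move=> fK k; case: (ltnP k #|X|) => [/enc_onto[x ->]|hk]; first by rewrite !code_enc fK.
by rewrite !code_out.
Qed.

Definition code (f : permgrp X) : permgrp nat := Bij (code_cancel (bfK f)) (code_cancel (biK f)).

Lemma codeE (f : permgrp X) x : (code f : bij nat) (enc x) = enc ((f : bij X) x).
Proof. exact: code_enc. Qed.

Lemma code_hom : is_hom code.
Proof.
move=> f g; apply: bij_ext => k; case: (ltnP k #|X|) => [/enc_onto[x ->]|hk].
  by rewrite /= !code_enc.
by rewrite /= !code_out.
Qed.

Lemma code_inj f : code f = gone -> f = gone.
Proof.
move=> h; apply: bij_ext => x; apply: enc_inj; rewrite boneE -code_enc.
exact: (congr1 (fun s : permgrp nat => (s : bij nat) (enc x)) h).
Qed.

End Coding.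

Section CosetAction.
Variables (B : grp) (M : B -> Prop).
Hypotheses (hM : is_subgroup M) (fiM : finite_index M).

(** This is left multiplication on the cosets of [M]. An element acting trivially fixes the coset of
    [gone], hence lies in [M]. *)
Lemma coset_action : exists (Z : finType) (psi : B -> permgrp Z),
  [/\ is_hom psi, forall x z, exists b, (psi b : bij Z) x = z, inhabited Z &
      forall b, psi b = gone -> M b].
Proof.
case: fiM => k [r hr].
pose P g i : bool := if excluded_middle_informative (M (ginv (r i) ** g)) then true else false.
have PE g i : reflect (M (ginv (r i) ** g)) (P g i).
  by rewrite /P; case: excluded_middle_informative => h; constructor.
have [d _] := hr gone.
(* The family [r] may repeat cosets. One index is selected for each coset, and [Z] keeps just the
   selected indices. *)
pose cls g := odflt d [pick i | P g i].
have clsP g : M (ginv (r (cls g)) ** g).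
  rewrite /cls; case: pickP => [i /PE //|h].
  by have [i /PE] := hr g; rewrite h.
have cls_eq g h : M (ginv g ** h) -> cls g = cls h.
  move=> hgh; congr odflt; apply: eq_pick => i; apply/PE/PE => hi.
    by rewrite -[h](gmulK g) gmulA; exact: subM.
  rewrite -[g](gmulK h) gmulA; apply: subM => //.
  by rewrite -[ginv h ** g]ginvK ginvM ginvK; exact: subV.
have eq_cls g h : cls g = cls h -> M (ginv g ** h).
  move=> e; have := clsP h; rewrite -e => hh.
  have := subM hM (subV hM (clsP g)) hh.
  by rewrite ginvM ginvK -gmulA (gmulK (r (cls g))).
pose inim i : bool := if excluded_middle_informative (exists g, cls g = i) then true else false.
have inimP i : reflect (exists g, cls g = i) (inim i).
  by rewrite /inim; case: excluded_middle_informative => h; constructor.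
pose Z := {i : 'I_k | inim i}.
have ex (x : Z) : {g | cls g = val x}.
  by apply: constructive_indefinite_description; apply/inimP; exact: (valP x).
pose rep x := proj1_sig (ex x).
have repE x : cls (rep x) = val x := proj2_sig (ex x).
have cin g : inim (cls g) by apply/inimP; exists g.
pose pt g : Z := Sub (cls g) (cin g).
have ptrep x : pt (rep x) = x by apply: val_inj; rewrite /= repE.
have eqpt g h : M (ginv g ** h) -> pt g = pt h by move=> /cls_eq e; apply: val_inj.
have reppt g : M (ginv (rep (pt g)) ** g) by apply: eq_cls; rewrite repE.
pose f b x := pt (b ** rep x).
have fpt b g : f b (pt g) = pt (b ** g).
  by apply: eqpt; rewrite ginvM -gmulA gmulKV.
have f1 x : f gone x = x by rewrite /f gmul1 ptrep.
have fM a b x : f (a ** b) x = f a (f b x) by rewrite -(ptrep x) !fpt gmulA.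
exists Z, (action_perm f1 fM); split; first exact: action_hom.
- move=> x z; exists (rep z ** ginv (rep x)).
  by rewrite /= /f gmulrKV ptrep.
- by constructor; exact: pt gone.
- move=> b hb; have : f b (pt gone) = pt gone.
    exact: (congr1 (fun s : permgrp Z => (s : bij Z) (pt gone)) hb).
  rewrite fpt gmul1r => /(congr1 val) /= /esym /eq_cls.
  by rewrite ginv1 gmul1.
Qed.

End CosetAction.

(* Every element recurs infinitely often, so that all tails of the levels separate elements. *)
Lemma infinite_enumeration (B : grp) : finitely_generated B ->
  exists e : nat -> B, forall b n0, exists2 n, n0 <= n & e n = b.
Proof.
case=> k [g hg].
pose ew (w : seq ('I_k * bool)) : B :=
  foldr (fun ib a => (if ib.2 then g ib.1 else ginv (g ib.1)) ** a) gone w.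
have ew_cat u w : ew (u ++ w) = ew u ** ew w.
  by elim: u => [|ib u IH] /=; rewrite ?gmul1 // IH gmulA.
have hS : is_subgroup (fun b => exists w, ew w = b).
  split; first by exists [::].
  - by move=> _ _ [u <-] [w <-]; exists (u ++ w).
  - move=> _ [w <-]; exists (rev (map (fun ib => (ib.1, ~~ ib.2)) w)).
    elim: w => [|[i b] w IH] /=; first by rewrite ginv1.
    rewrite rev_cons -cats1 ew_cat IH ginvM /= gmul1r; congr (_ ** _).
    by case: b => //=; rewrite ginvK.
pose e n := if @unpickle (nat * seq ('I_k * bool))%type n is Some jw then ew jw.2 else gone.
exists e => b n0.
have [w <-] : exists w, ew w = b.
  apply: (gen_min hS _ (hg b)) => _ [i ->].
  by exists [:: (i, true)]; rewrite /= gmul1r.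
(* The dummy counter [j] gives [n0.+1] different codes of the same word, and these cannot all be
   below [n0]. *)
pose s := [seq pickle (j, w) | j <- iota 0 n0.+1].
have hu : uniq s.
  rewrite map_inj_uniq ?iota_uniq // => i j /(pcan_inj pickleK).
  by case.
have [/allP h|/allPn[x]] := boolP (all (fun x => x < n0) s).
  have /uniq_leq_size-/(_ (iota 0 n0)) := hu.
  rewrite size_map !size_iota ltnn => h'; suff : false by []; apply: h' => x /h.
  by rewrite mem_iota.
case/mapP => j _ ->; rewrite -leqNgt => hn; exists (pickle (j, w)) => //.
by rewrite /e pickleK.
Qed.

Lemma sqr_le_exp2 j : 4 <= j -> j * j <= 2 ^ j.
Proof.
elim: j => // j IH; rewrite leq_eqVlt => /orP[/eqP <- //|hj].
have h4 : 4 <= j by [].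
by have := IH h4; rewrite expnS; nia.
Qed.

(* [2 ^ q] bounds the order of the finite group acting on the coordinates of the grid. *)
Definition grid_size (q n : nat) : nat := 2 ^ (20 * (n + q + 1)).

(** This is the counting inequality for [unreachable]: the summands count the points [y i] to be
    placed and the reachable ones. As [r] is exponential in [n + q], the logarithm of the word
    count, about [k * n * r], stays below [r * r]. *)
Lemma grid_size_bound (n q : nat) (r := grid_size q n) :
  (2 * grid_size q n.+1).+1 + ((2 * r).+1 * 2 ^ q) ^ (3 * (n * (2 * r).+1)) * 2 ^ q
    <= 2 ^ (r * r).
Proof.
have [k hk rk] : exists2 k, k = 20 * (n + q + 1) & r = 2 ^ k by exists (20 * (n + q + 1)).
have -> : grid_size q n.+1 = 2 ^ (k + 20) by rewrite /grid_size hk; congr (2 ^ _); lia.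
move: r rk => r rk.
have kk : k * k <= 2 ^ k by apply: sqr_le_exp2; lia.
have k2 : k < 2 ^ k by exact: ltn_expl.
rewrite -rk in kk k2.
have h1 : (2 * r).+1 <= 2 ^ (k + 2) by rewrite rk expnD; lia.
have h3 : (2 * r).+1 <= 3 * r by lia.
set E := (k + 2 + q) * (9 * n * r) + q.
have hR : ((2 * r).+1 * 2 ^ q) ^ (3 * (n * (2 * r).+1)) * 2 ^ q <= 2 ^ E.
  rewrite /E expnD leq_mul2r; apply/orP; right.
  apply: (@leq_trans ((2 ^ (k + 2 + q)) ^ (3 * (n * (2 * r).+1)))).
    case: (posnP (3 * (n * (2 * r).+1))) => [-> //|h0].
    by rewrite leq_exp2r // expnD leq_mul2r h1 orbT.
  rewrite -expnM leq_exp2l //.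
  have -> : 9 * n * r = 3 * (n * (3 * r)) by nia.
  by rewrite !leq_mul2l h3 !orbT.
have e1 : (k + 2 + q) * (9 * n) + q < r by apply: leq_trans kk; nia.
have hE : E.+1 <= r * r by rewrite /E; nia.
have hI : (2 * 2 ^ (k + 20)).+1 <= 2 ^ (r * r).-1.
  apply: (@leq_trans (2 ^ (k + 22))); last by rewrite leq_exp2l //; nia.
  have -> : k + 22 = (k + 20).+2 by lia.
  have : 0 < 2 ^ (k + 20) by rewrite expn_gt0.
  by rewrite !expnS; move: (2 ^ (k + 20)) => K hK; lia.
(* One half of the available points is reserved for each summand. *)
have -> : 2 ^ (r * r) = 2 ^ (r * r).-1 + 2 ^ (r * r).-1.
  by rewrite addnn -mul2n -expnS prednK //; lia.
by apply: leq_add hI _; apply: leq_trans hR _; rewrite leq_exp2l //; lia.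
Qed.

(** * Grid-shaped levels *)

Lemma perm_iter_fact N (s : 'S_N) (x : 'I_N) : iter N`! s x = x.
Proof. by rewrite -permX -card_Sn -cardsT expg_cardG ?inE // perm1. Qed.

Lemma fun_mulE (I : Type) (Q : grp) (f g : fungrp I Q) i : (f ** g) i = f i ** g i.
Proof. by []. Qed.

Lemma avoid_two N (a b : 'I_N) : 2 < N -> exists c, c <> a /\ c <> b.
Proof.
move=> N3; have [c hc|h] := pickP (fun c => (c != a) && (c != b)).
  by exists c; case/andP: hc => /eqP h1 /eqP h2.
have : #|'I_N| <= #|[set a; b]|.
  apply: subset_leq_card; apply/subsetP => c _; rewrite !inE.
  by move: (h c); case: (c == a); case: (c == b).
by rewrite card_ord cards2 => h'; case: (a != b) h'; lia.
Qed.

Lemma fun_invE (I : Type) (Q : grp) (f : fungrp I Q) i : (ginv f : fungrp I Q) i = ginv (f i).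
Proof. by []. Qed.

Section Level.
Variables (B : grp) (N r : nat) (pi : B -> {perm 'I_N}) (Z : finType) (psi : B -> permgrp Z).
Hypothesis pi1 : forall x, pi gone x = x.
Hypothesis piM : forall a b x, pi (gmul a b) x = pi a (pi b x).
Hypothesis psi_hom : is_hom psi.
Hypothesis B_perfect : perfect B.

Definition grid : finType := ('I_r * 'I_r)%type.
Definition cell : finType := ({ffun grid -> 'I_N} * Z)%type.
(** [Some (true, p)] and [Some (false, p)] are the row and the column number [p]; [None] is the
    additional copy of [B], which acts on [Z] only. *)
Definition line : finType := option (bool * 'I_r).

Definition cgrp : grp := prodgrp (fungrp grid B) B.

Definition cell_fun (u : cgrp) (x : cell) : cell :=
  ([ffun j => pi (u.1 j) (x.1 j)], (psi u.2 : bij Z) x.2).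

Lemma cell_fun1 x : cell_fun gone x = x.
Proof.
case: x => f z; congr (_, _); last by rewrite (hom1 psi_hom).
by apply/ffunP => j; rewrite ffunE; exact: pi1.
Qed.

Lemma cell_funM u v x : cell_fun (u ** v) x = cell_fun u (cell_fun v x).
Proof.
congr (_, _); last exact: (congr1 (fun s : permgrp Z => (s : bij Z) x.2) (psi_hom u.2 v.2)).
by apply/ffunP => j; rewrite !ffunE; exact: piM.
Qed.

Definition cell_perm : cgrp -> permgrp cell := action_perm cell_fun1 cell_funM.

Lemma cell_perm_hom : is_hom cell_perm. Proof. exact: action_hom. Qed.

Definition on_line (i : line) (j : grid) : bool :=
  if i is Some (row, p) then (if row then j.1 else j.2) == p else false.

Definition line_elt (i : line) (b : B) : cgrp :=
  (fun j => if on_line i j then b else gone, if i is None then b else gone).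

Lemma line_elt_hom i : is_hom (line_elt i).
Proof.
move=> a b; congr (_, _); last by case: i => [i|] //=; rewrite gmul1.
by apply: functional_extensionality => j; rewrite fun_mulE /=; case: ifP; rewrite ?gmul1.
Qed.

Definition lines : cgrp -> Prop := gen (fun u => exists i b, u = line_elt i b).

Definition single (j : grid) (b : B) : cgrp := (fun j' => if j' == j then b else gone, gone).

(* A row and a column meet in one point of the grid, so commutators isolate coordinates. *)
Lemma lines_single j b : lines (single j b).
Proof.
have hom : is_hom (single j).
  move=> c d; congr (_, _); last by rewrite gmul1.
  by apply: functional_extensionality => j'; rewrite fun_mulE /=; case: ifP; rewrite ?gmul1.
have := B_perfect b; apply: (gen_hom hom (gen_is_subgroup _)) => _ [c [d ->]].
suff -> : single j (gcomm c d) =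
    gcomm (line_elt (Some (true, j.1)) c) (line_elt (Some (false, j.2)) d).
  by apply: (sub_comm (gen_is_subgroup _)); apply: gen_in; do 2!eexists.
congr (_, _); last by symmetry; exact: (gcomm1r (gone : B)).
apply: functional_extensionality => j'.
rewrite -[RHS]/(gcomm (if j'.1 == j.1 then c else gone) (if j'.2 == j.2 then d else gone)).
rewrite -[j' == j]/((j'.1 == j.1) && (j'.2 == j.2)).
by case: eqP => _ /=; [case: eqP => _|]; rewrite ?gcomm1l ?gcomm1r.
Qed.

(** Although few copies of [B] generate, the rooted group acts on all coordinates independently;
    this gives transitivity and the isolating permutations. *)
Lemma lines_all u : lines u.
Proof.
have hL : is_subgroup lines by exact: gen_is_subgroup.
case: u => s t.
have -> : ((s, t) : cgrp) = ((s, gone) : cgrp) ** line_elt None t.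
  congr (_, _); last by rewrite gmul1.
  by apply: functional_extensionality => j; rewrite fun_mulE /= gmul1r.
apply: (subM hL); last by apply: gen_in; exists None, t.
suff h (l : seq grid) : lines (fun j => if j \in l then s j else gone, gone).
  have := h (enum grid); congr lines; congr (_, _).
  by apply: functional_extensionality => j; rewrite mem_enum.
elim: l => [|j l IH].
  exact: (sub1 hL).
have [hj|hj] := boolP (j \in l).
  move: IH; congr lines; congr (_, _); apply: functional_extensionality => j'.
  by rewrite inE; case: eqP => [->|//]; rewrite hj.
have := subM hL (lines_single j (s j)) IH; congr lines; congr (_, _); last by rewrite gmul1.
apply: functional_extensionality => j'; rewrite fun_mulE /= inE.
by case: eqP => [->|_]; rewrite ?(negbTE hj) ?gmul1 ?gmul1r.
Qed.

Variables (c0 c1 : 'I_N) (z0 : Z).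
Hypothesis c01 : c0 != c1.

(** The candidates for [o] and the [y i] are the cells with entries [c0], [c1] and a fixed point of
    [Z]. The value [c2] is left free for moving points away from all candidates. *)
Definition pos (e : {ffun grid -> bool}) : {ffun grid -> 'I_N} := [ffun j => if e j then c1 else c0].
Definition pt (e : {ffun grid -> bool}) : cell := (pos e, z0).

Lemma posE e j : pos e j = if e j then c1 else c0.
Proof. by rewrite ffunE. Qed.

Lemma pos_inj : injective pos.
Proof.
move=> e e' /ffunP h; apply/ffunP => j; move: (h j); rewrite !ffunE.
by case: (e j); case: (e' j) => // h'; move: c01; rewrite h' eqxx.
Qed.

Lemma pt_inj : injective pt. Proof. by move=> e e' [/pos_inj]. Qed.

(* The action of a word of line elements on the grid part of a cell; [None] pads words. *)
Definition grid_letter (a : line * {perm 'I_N}) (f : {ffun grid -> 'I_N}) : {ffun grid -> 'I_N} :=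
  [ffun j => if on_line a.1 j then a.2 (f j) else f j].
Definition grid_word (w : seq (line * {perm 'I_N})) f := foldr grid_letter f w.

Lemma grid_word_perm w : exists s : grid -> {perm 'I_N}, forall f j, grid_word w f j = s j (f j).
Proof.
elim: w => [|a w [s hs]]; first by exists (fun=> 1%g) => f j; rewrite perm1.
exists (fun j => if on_line a.1 j then (s j * a.2)%g else s j) => f j.
by rewrite /= ffunE hs; case: ifP; rewrite ?permM.
Qed.

Lemma grid_word_period w f : iter N`! (grid_word w) f = f.
Proof.
have [s hs] := grid_word_perm w.
have h t j : iter t (grid_word w) f j = iter t (s j) (f j) by elim: t => //= t IH; rewrite hs IH.
by apply/ffunP => j; rewrite h perm_iter_fact.
Qed.

(** A word acts by a permutation of ['I_N] in each coordinate, so its exponents matter only modulo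
    the factorial of [N], independently of the grid size. This keeps the count of reachable points
    small. *)
Lemma grid_word_mod w t f : iter t (grid_word w) f = iter (t %% N`!) (grid_word w) f.
Proof.
rewrite {1}(divn_eq t N`!) addnC iterD; congr iter.
by elim: (t %/ N`!) => //= d IH; rewrite mulSn iterD IH grid_word_period.
Qed.

Definition cell_word (w : seq (line * B)) : permgrp cell :=
  foldr (fun ib s => cell_perm (line_elt ib.1 ib.2) ** s) gone w.

Lemma cell_word_grid w x :
  ((cell_word w : bij cell) x).1 = grid_word [seq (ib.1, pi ib.2) | ib <- w] x.1.
Proof.
elim: w => [//|[i b] w IH].
rewrite -[LHS]/((cell_fun (line_elt i b) ((cell_word w : bij cell) x)).1) /= -IH.
by apply/ffunP => j; rewrite !ffunE /=; case: ifP.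
Qed.

Lemma cell_word_cat u w : cell_word (u ++ w) = cell_word u ** cell_word w.
Proof. by elim: u => [|a u IH] /=; rewrite ?gmul1 // IH gmulA. Qed.

Lemma cell_word_inv w : exists2 w', size w' = size w & cell_word w' = ginv (cell_word w).
Proof.
exists (rev [seq (ib.1, ginv ib.2) | ib <- w]); first by rewrite size_rev size_map.
elim: w => [|[i b] w IH] /=; first by rewrite ginv1.
rewrite rev_cons -cats1 cell_word_cat IH ginvM; congr (@gmul (permgrp cell) _ _).
by rewrite /cell_word /= gmul1r (homV (line_elt_hom i)) (homV cell_perm_hom).
Qed.

Definition grid_words L : finType := L.-tuple (line * {perm 'I_N}).

Lemma unreachable L (S : finType) :
  #|S| + ((2 * r).+1 * N`!) ^ (3 * L) * N`! <= 2 ^ (r * r) ->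
  exists e : S -> {ffun grid -> bool}, injective e /\
    forall i u v w t, size u <= L -> size v <= L -> size w <= L ->
      grid_word u (iter t (grid_word v) (grid_word w (pos [ffun=> false]))) <> pos (e i).
Proof.
move=> hS.
(* Every reachable cell comes from three words padded to length [L] and one reduced exponent; the
   hypothesis leaves at least [#|S|] patterns outside the image of [F]. *)
pose D : finType := (grid_words L * grid_words L * grid_words L * 'I_(N`!))%type.
pose F (d : D) : {ffun grid -> 'I_N} := grid_word d.1.1.1 (iter d.2 (grid_word d.1.1.2) (grid_word d.1.2 (pos [ffun=> false]))).
pose good : {set {ffun grid -> bool}} := [set e | pos e \notin codom F].
have hgood : #|S| <= #|good|.
  have hbad : #|~: good| <= #|D|.
    have -> : #|~: good| = #|[set pos e | e in ~: good]| by rewrite card_imset //; exact: pos_inj.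
    apply: leq_trans (leq_image_card F xpredT).
    apply: subset_leq_card; apply/subsetP => f /imsetP[e]; rewrite !inE negbK => he ->.
    exact: he.
  have hD : #|D| = ((2 * r).+1 * N`!) ^ (3 * L) * N`!.
    rewrite !card_prod !card_tuple card_ord card_prod card_option card_prod card_bool card_ord.
    rewrite card_Sn -!expnD; congr (_ ^ _ * _); lia.
  have := cardsC good; rewrite card_ffun card_bool card_prod card_ord.
  by move: hS hbad; rewrite hD; lia.
pose e0 (i : S) : {ffun grid -> bool} := enum_val (widen_ord hgood (enum_rank i)).
exists e0; split.
  by move=> i j /enum_val_inj /(congr1 val) /= /val_inj /enum_rank_inj.
move=> i u v w t hu hv hw h.
have : e0 i \in good by exact: enum_valP.
rewrite inE -h => /negP; apply.
have pad x : size x <= L -> exists T : grid_words L, forall f, grid_word T f = grid_word x f.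
  move=> hx; have hs : size (x ++ nseq (L - size x) (None, 1%g)) == L.
    by rewrite size_cat size_nseq subnKC.
  exists (Tuple hs) => f; rewrite /grid_word /= foldr_cat; congr foldr.
  elim: (L - size x) => //= d ->; apply/ffunP => j; by rewrite ffunE.
have [U hU] := pad u hu; have [V hV] := pad v hv; have [W hW] := pad w hw.
have hN : t %% N`! < N`! by rewrite ltn_mod fact_gt0.
apply/codomP; exists (U, V, W, Ordinal hN); rewrite /F /= hU hW grid_word_mod; congr grid_word.
by apply: eq_iter => f; rewrite hV.
Qed.

Hypothesis pi2 : forall a b c, a <> b -> a <> c -> exists x, pi x a = a /\ pi x b = c.
Hypothesis N3 : 2 < N.
Hypothesis psi_trans : forall x z, exists b, (psi b : bij Z) x = z.

Lemma cell_trans x z : exists u, (cell_perm u : bij cell) x = z.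
Proof.
have hj (j : grid) : {b | pi b (x.1 j) = z.1 j}.
  apply: constructive_indefinite_description.
  (* [pi2] moves one point while fixing another, so an auxiliary point to fix is needed. *)
  have [c [h1 h2]] := avoid_two (x.1 j) (z.1 j) N3.
  by have [b [_ hb]] := pi2 h1 h2; exists b.
have [t ht] := psi_trans x.2 z.2.
exists (fun j => proj1_sig (hj j), t); case: z hj ht => zf zz hj /= ht.
rewrite /cell_fun /= ht; congr (_, _); apply/ffunP => j; rewrite ffunE.
exact: (proj2_sig (hj j)).
Qed.

Variable c2 : 'I_N.
Hypotheses (c02 : c0 != c2) (c12 : c1 != c2).

(** In each coordinate the permutation fixes the entry of [e] and sends the opposite one to [c2]. A
    pattern differing from [e] anywhere thus acquires an entry [c2] and leaves the set of
    candidates. *)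
Lemma cell_isolating e : exists u, (cell_perm u : bij cell) (pt e) = pt e /\
  forall e' e'', (cell_perm u : bij cell) (pt e') = pt e'' -> e' = e.
Proof.
have hj (j : grid) : {b | pi b (pos e j) = pos e j /\ pi b (if e j then c0 else c1) = c2}.
  apply: constructive_indefinite_description; rewrite ffunE; case: (e j); apply: pi2; apply/eqP => //.
  by rewrite eq_sym.
exists (fun j => proj1_sig (hj j), gone); split.
  congr (_, _) => /=; last by rewrite (hom1 psi_hom).
  by apply/ffunP => j; rewrite ffunE; case: (proj2_sig (hj j)).
move=> e' e'' [/ffunP h _]; apply/ffunP => j; move: (h j).
rewrite ffunE /=; have [_] := proj2_sig (hj j); move: (proj1_sig (hj j)) => b hb.
rewrite !posE.
have [//|ne] := eqVneq (e' j) (e j).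
have -> : (if e' j then c1 else c0) = (if e j then c0 else c1).
  by move: ne; case: (e' j); case: (e j).
by rewrite hb => /eqP; case: (e'' j); rewrite eq_sym ?(negbTE c12) ?(negbTE c02).
Qed.

End Level.

(** * Assembly of the levels into a branch group containing [B] *)

Section Assembly.
Variables (C : grp -> Prop) (B : grp) (N : nat) (pi : B -> {perm 'I_N}).
Hypothesis Ciso : group_class C.
Hypothesis Csub : subgroup_closed C.
Hypothesis Cprod : dirprod_closed C.
Hypothesis B_fg : finitely_generated B.
Hypothesis B_perfect : perfect B.
Hypothesis B_powC : locally_up_to_powers C B.
Hypothesis B_rf : forall b : B, b <> gone -> exists M, [/\ is_subgroup M, finite_index M & ~ M b].
Hypothesis pi1 : forall x, pi gone x = x.
Hypothesis piM : forall a b x, pi (gmul a b) x = pi a (pi b x).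
Hypothesis pi2 : forall a b c, a <> b -> a <> c -> exists x, pi x a = a /\ pi x b = c.
Hypothesis N3 : 2 < N.

(** A transitive finite action detecting the single element [b]; level [n] uses the one for the
    [n]-th term of the enumeration. *)
Record coset_data (b : B) := CosetData {
  cd_Z : finType; cd_psi : B -> permgrp cd_Z; cd_z0 : cd_Z;
  cd_hom : is_hom cd_psi;
  cd_trans : forall x z, exists c, (cd_psi c : bij cd_Z) x = z;
  cd_faithful : cd_psi b = gone -> b = gone }.

Lemma coset_data_ex b : inhabited (coset_data b).
Proof.
have [M [hM fM hb]] : exists M, [/\ is_subgroup M, finite_index M & M b -> b = gone].
  case: (classic (b = gone)) => [->|nb]; last first.
    by have [M [h1 h2 h3]] := B_rf nb; exists M; split=> // /h3.
  (* For trivial [b] the whole group, with its single coset, serves. *)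
  exists (fun=> True); split=> //; exists 1, (fun=> gone) => g; by exists ord0.
have [Z [psi [h1 h2 [z0] h3]]] := coset_action hM fM.
by constructor; apply: (@CosetData b Z psi z0) => // /h3.
Qed.

Lemma branch_overgroup : exists Gam : grp,
  [/\ embeds B Gam, finitely_generated Gam, perfect Gam, branch_group Gam & locally_up_to_powers C Gam].
Proof.
have [e he] := infinite_enumeration B_fg.
have cd n : coset_data (e n).
  exact: proj1_sig (constructive_indefinite_description _
    (let: inhabits x := coset_data_ex (e n) in ex_intro (fun=> True) x I)).
(* A crude exponent, sufficient to bound the factorial of [N] by a power of two. *)
pose q := N`!; have qN : N`! <= 2 ^ q by exact: ltnW (ltn_expl _ _).
pose r := grid_size q.
pose Z n := cd_Z (cd n); pose psi n := cd_psi (cd n).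
have psi_hom n : is_hom (psi n) := cd_hom (cd n).
have psi_trans n x z := cd_trans (c := cd n) x z.
pose X n := cell N (r n) (Z n); pose L n := line (r n).
pose cp n := @cell_perm B N (r n) pi (Z n) (psi n) pi1 piM (psi_hom n).
have cp_hom n : is_hom (@cp n) by exact: cell_perm_hom.
pose rho n (i : L n) (b : B) := code (cp n (line_elt i b)).
pose c0 : 'I_N := Ordinal (ltnW (ltnW N3)); pose c1 : 'I_N := Ordinal (ltnW N3).
pose c2 : 'I_N := Ordinal N3.
have c01 : c0 != c1 by []. have c02 : c0 != c2 by []. have c12 : c1 != c2 by [].
pose z0 n := cd_z0 (cd n).
pose P n := @pt N (r n) (Z n) c0 c1 (z0 n).
have Pinj n : injective (P n) by exact: pt_inj.
have hsel n : {s : L n.+1 -> {ffun grid (r n) -> bool} | injective s /\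
    forall i u v w t, size u <= n * #|L n| -> size v <= n * #|L n| -> size w <= n * #|L n| ->
      grid_word u (iter t (grid_word v) (grid_word w (pos c0 c1 [ffun=> false]))) <> pos c0 c1 (s i)}.
  apply: constructive_indefinite_description; apply: unreachable => //.
  have hL k : #|L k| = (2 * r k).+1 by rewrite card_option card_prod card_bool card_ord.
  rewrite !hL; apply: leq_trans (grid_size_bound n q); rewrite leq_add2l.
  apply: leq_mul => //; case: (posnP (3 * (n * (2 * r n).+1))) => [-> //|h0].
  by rewrite leq_exp2r // leq_mul2l qN orbT.
pose s n := proj1_sig (hsel n).
have sP n : injective (s n) /\
    forall i u v w t, size u <= n * #|L n| -> size v <= n * #|L n| -> size w <= n * #|L n| ->
      grid_word u (iter t (grid_word v) (grid_word w (pos c0 c1 [ffun=> false]))) <> pos c0 c1 (s n i)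
  := proj2_sig (hsel n).
pose m n := #|X n|.
pose o n := enc (P n [ffun=> false]).
pose y n (i : L n.+1) := enc (P n (s n i)).
have rho_hom n i : is_hom (@rho n i).
  by move=> a b; rewrite /rho line_elt_hom cp_hom code_hom.
have rho_out n (i : L n) b x : m n <= x -> (rho n i b : bij nat) x = x.
  by move=> hx; exact: code_out.
have o_lt n : o n < m n by exact: enc_lt.
have y_lt n (i : L n.+1) : y n i < m n by exact: enc_lt.
have y_neq_o n (i : L n.+1) : y n i != o n.
  apply/eqP => /enc_inj/Pinj e0; have [_ h] := sP n.
  (* With empty words, unreachability says that [y n i] differs from [o n]. *)
  by apply: (h i [::] [::] [::] 0) => //=; rewrite e0.
have y_inj n : injective (y n).
  by move=> i j /enc_inj/Pinj; have [h _] := sP n; exact: h.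
have m2 n : 2 <= m n.
  have := y_neq_o n None; have := o_lt n; have := y_lt n None.
  by move: (y n None) (o n) (m n) => a b c; lia.
have Rt_code n u : Rt rho n (code (cp n u)).
  have hom : is_hom (fun v => code (cp n v)) by move=> a b; rewrite cp_hom code_hom.
  have := lines_all B_perfect u; apply: (gen_hom hom (gen_is_subgroup _)) => _ [i [b ->]].
  by apply: gen_in; exists i, b.
have Rt_trans n x z : x < m n -> z < m n -> exists2 a, Rt rho n a & (a : bij nat) x = z.
  move=> /enc_onto[x' ->] /enc_onto[z' ->].
  have [u hu] := cell_trans pi1 piM (psi_hom n) pi2 N3 (psi_trans n) x' z'.
  by exists (code (cp n u)); [exact: Rt_code|rewrite codeE hu].
have dirptP n x : dirpt o y n x -> exists2 e', x = enc (P n e') &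
    e' = [ffun=> false] \/ exists j, e' = s n j.
  case=> [->|[j ->]]; first by exists [ffun=> false]; [|left].
  by exists (s n j) => //; right; exists j.
have isolating n (i : L n.+1) : exists a, [/\ Rt rho n a, (a : bij nat) (y n i) = y n i &
    forall x, dirpt o y n x -> dirpt o y n ((a : bij nat) x) -> x = y n i].
  have [u [h1 h2]] := cell_isolating pi1 piM (psi_hom n) (z0 n) c01 pi2 c02 c12 (s n i).
  exists (code (cp n u)); split; first exact: Rt_code.
    by rewrite codeE h1.
  move=> x /dirptP[e' -> _] /dirptP[e'' + _]; rewrite codeE => /enc_inj/h2 ->.
  by [].
have faithful n0 b : (forall n (i : L n.+1), n0 <= n -> rho n.+1 i b = gone) -> b = gone.
  (* An occurrence of [b] with index at least [n0.+1] is a successor [n.+1] with [n0 <= n]; there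
     the copy [None] acts by an action detecting [b]. *)
  move=> h; have [[|n] // hn en] := he b n0.+1.
  have : rho n.+1 None (e n.+1) = gone by rewrite en; exact: h.
  move=> /code_inj hb; rewrite -en; apply: (cd_faithful (c := cd n.+1)); apply: bij_ext => z.
  exact: (congr1 (fun a : permgrp (X n.+1) => ((a : bij _) ([ffun=> c0], z)).2) hb).
have evE n (u : seq (L n * B)) : ev_root rho u = code (cell_word pi1 piM (psi_hom n) u).
  elim: u => [|ib u IH]; first by rewrite /= (hom1 (@code_hom _)).
  by rewrite /= IH code_hom.
have avoid n (u v w : seq (L n * B)) t i :
  size u <= n * #|L n| -> size v <= n * #|L n| -> size w <= n * #|L n| ->
  ((ev_root rho u ** gpow (ev_root rho v) t ** ginv (ev_root rho w) : permgrp nat) : bij nat) (o n)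
    <> y n i.
  move=> hu hv hw; have [w' sw' ew'] := cell_word_inv pi1 piM (psi_hom n) w.
  rewrite !evE -(homV (@code_hom _)) -ew' -(hom_pow (@code_hom _)) -!code_hom.
  rewrite codeE => /enc_inj h.
  have [_ hs] := sP n.
  pose g (x : seq (L n * B)) := [seq (ib.1, pi ib.2) | ib <- x].
  apply: (hs i (g u) (g v) (g w') t); rewrite ?size_map ?sw' //.
  have -> : pos c0 c1 (s n i) = (P n (s n i)).1 by [].
  rewrite -h !bmulE cell_word_grid bpowE; congr grid_word.
  elim: t {h} => [|t IH]; first by rewrite /= cell_word_grid.
  by rewrite !iterS cell_word_grid IH.
exists (GamG rho o y); split.
- exact: (GamG_embeds rho_hom y_neq_o y_inj faithful).
- exact: GamG_fg.
- exact: (GamG_perfect rho_hom B_perfect).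
- exact: (GamG_branch m2 rho_hom rho_out o_lt y_lt y_neq_o y_inj B_perfect Rt_trans isolating).
- exact: (GamG_powC m2 rho_hom rho_out o_lt y_lt y_neq_o y_inj Ciso Csub Cprod B_powC faithful avoid).
Qed.

End Assembly.

(** * Embedding into a perfect group *)

Section Lattice.
Local Open Scope ring_scope.
Variables (k : nat) (Lam : 'rV[int]_k -> Prop).
Hypotheses (Lam0 : Lam 0) (LamB : forall u v, Lam u -> Lam v -> Lam (u - v)).

Lemma Lam_opp u : Lam u -> Lam (- u).
Proof. by move=> hu; rewrite -sub0r; exact: LamB. Qed.

Lemma Lam_add u v : Lam u -> Lam v -> Lam (u + v).
Proof. by move=> hu hv; rewrite -(opprK v); apply: LamB => //; exact: Lam_opp. Qed.

Lemma Lam_muln u n : Lam u -> Lam (u *+ n).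
Proof. by move=> hu; elim: n => [|n IH]; rewrite ?mulr0n // mulrS; exact: Lam_add. Qed.

Lemma Lam_scale (a : int) u : Lam u -> Lam (a *: u).
Proof.
move=> hu; case: a => n; last (rewrite NegzE scaleNr; apply: Lam_opp).
  by rewrite -natz scaler_nat; exact: Lam_muln.
by rewrite -natz scaler_nat; exact: Lam_muln.
Qed.

Lemma Lam_sum (I : finType) (F : I -> 'rV[int]_k) : (forall i, Lam (F i)) -> Lam (\sum_i F i).
Proof. by move=> h; elim/big_ind: _ => //; exact: Lam_add. Qed.

(* A multiple of the projection of [Q^k] along the rational span of the lattice. *)
Lemma lattice_projection : exists (d : nat) (P : 'M[int]_k),
  [/\ (0 < d)%N, forall u, Lam u -> u *m P = 0 &
      forall i, Lam (delta_mx 0 i *+ d - row i P)].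
Proof.
pose sup (J : {set 'I_k}) (u : 'rV[int]_k) := forall j, j \notin J -> u 0 j = 0.
pose indep J : bool :=
  if excluded_middle_informative (forall u, Lam u -> sup J u -> u = 0) then true else false.
have indepP J : reflect (forall u, Lam u -> sup J u -> u = 0) (indep J).
  by rewrite /indep; case: excluded_middle_informative => h; constructor.
(* For a maximal such [J], the vectors supported in [J] form a rational complement of the span of
   the lattice. *)
have [J /maxsetP[/indepP hJ Jmax]] : {J | maxset indep J}.
  apply: ex_maxset; exists set0; apply/indepP => u _ hu.
  by apply/rowP => j; rewrite mxE hu // inE.
have hap i : exists ap : nat * 'rV[int]_k,
    [/\ (0 < ap.1)%N, sup J ap.2 & Lam (delta_mx 0 i *+ ap.1 - ap.2)].
  have [iJ|iJ] := boolP (i \in J).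
    exists (1%N, delta_mx 0 i); split=> //=; last by rewrite mulr1n subrr.
    by move=> j jJ; rewrite mxE /=; case: eqP => // ji; move: jJ; rewrite ji iJ.
  (* By maximality, adding [i] to [J] admits a nonzero lattice vector. Its entry at [i] cannot
     vanish, so it expresses a multiple of the [i]-th unit vector modulo the lattice by a vector
     supported in [J]. *)
  have [u [hu su u0]] : exists u, [/\ Lam u, sup (i |: J) u & u <> 0].
    apply: NNPP => h; have : i |: J = J.
      apply: Jmax; last exact: subsetUr.
      by apply/indepP => u hu su; apply: NNPP => u0; apply: h; exists u.
    by move/setP/(_ i); rewrite !inE eqxx (negbTE iJ).
  have sui j : j \notin J -> j != i -> u 0 j = 0.
    by move=> jJ ji; apply: su; rewrite !inE negb_or ji jJ.
  have ui : u 0 i != 0.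
    apply/eqP => ui; apply: u0; apply: hJ => // j jJ.
    by have [->//|] := eqVneq j i; exact: sui.
  exists (absz (u 0 i), delta_mx 0 i *+ absz (u 0 i) - sgz (u 0 i) *: u); split=> /=.
  - by rewrite absz_gt0.
  - move=> j jJ; rewrite -scaler_nat !mxE /=; have [->|ji] := eqVneq j i.
      by rewrite mulr1 natz abszEsg subrr.
    by rewrite (sui j jJ ji) mulr0n !mulr0 subr0.
  - by rewrite opprB addrC subrK; exact: Lam_scale.
have {}hap i : {ap : nat * 'rV[int]_k |
    [/\ (0 < ap.1)%N, sup J ap.2 & Lam (delta_mx 0 i *+ ap.1 - ap.2)]}.
  exact: constructive_indefinite_description.
pose a i := (proj1_sig (hap i)).1; pose p i := (proj1_sig (hap i)).2.
have apP i : [/\ (0 < a i)%N, sup J (p i) & Lam (delta_mx 0 i *+ a i - p i)] := proj2_sig (hap i).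
pose d := (\prod_i a i)%N; pose P := \matrix_i (p i *+ (d %/ a i)).
have da i : d = (a i * (d %/ a i))%N.
  by rewrite mulnC divnK // /d (bigD1 i) //= dvdn_mulr.
have hrow i : Lam (delta_mx 0 i *+ d - row i P).
  rewrite rowK {1}(da i) mulrnA -mulrnBl.
  by apply: Lam_muln; have [] := apP i.
exists d, P; split=> // [|u hu].
  by apply: prodn_gt0 => i; have [] := apP i.
(* The vector [u *m P] is a combination of lattice vectors and is supported in [J], hence
   vanishes. *)
apply: hJ => [|j jJ].
  have -> : u *m P = u *+ d - \sum_i u 0 i *: (delta_mx 0 i *+ d - row i P).
    have -> : u *+ d = \sum_i u 0 i *: delta_mx 0 i *+ d by rewrite {1}(row_sum_delta u) sumrMnl.
    rewrite mulmx_sum_row -sumrB; apply: eq_bigr => i _.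
    by rewrite scalerBr -scalerMnr opprB addrC subrK.
  apply: LamB; first exact: Lam_muln.
  by apply: Lam_sum => i; exact: Lam_scale.
rewrite mulmx_sum_row summxE big1 // => i _; rewrite mxE rowK -scaler_nat mxE.
by have [_ h _] := apP i; rewrite h // !mulr0.
Qed.

End Lattice.

Section IntPower.
Variables (G : grp) (x : G).

Definition zpow (n : int) : G :=
  match n with Posz m => gpow x m | Negz m => ginv (gpow x m.+1) end.

Lemma zpow_sub a b : zpow (a%:Z - b%:Z)%R = gpow x a ** ginv (gpow x b).
Proof.
case: (leqP b a) => h.
  by rewrite subzn // -{2}(subnK h) gpowD gmulrK.
have -> : (a%:Z - b%:Z)%R = Negz (b - a).-1 by lia.
rewrite /zpow prednK ?subn_gt0 // -{2}(subnK (ltnW h)) gpowD ginvM gmulK.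
by [].
Qed.

Lemma gpow_commute a b : gpow x a ** gpow x b = gpow x b ** gpow x a.
Proof. by rewrite -!gpowD addnC. Qed.

Lemma zpowD m n : zpow (m + n)%R = zpow m ** zpow n.
Proof.
have dec (i : int) : exists a b : nat, i = (a%:Z - b%:Z)%R.
  by case: i => a; [exists a, 0; lia|exists 0, a.+1; lia].
have [a [b ->]] := dec m; have [c [d ->]] := dec n.
have -> : (a%:Z - b%:Z + (c%:Z - d%:Z))%R = ((a + c)%:Z - (b + d)%:Z)%R by lia.
rewrite !zpow_sub !gpowD !ginvM -!gmulA; congr (_ ** _).
have e : gpow x c ** ginv (gpow x b) = ginv (gpow x b) ** gpow x c.
  by apply: (@gmul_cancel _ (gpow x b)); rewrite gmulK gmulA gpow_commute gmulrK.
rewrite [RHS]gmulA -e -gmulA; congr (_ ** _); rewrite -!ginvM; congr ginv; exact: gpow_commute.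
Qed.

Lemma zpowN n : zpow (- n)%R = ginv (zpow n).
Proof. by symmetry; apply: ginv_eq; rewrite -zpowD subrr. Qed.

End IntPower.

(** * Tuples with trivial product in the abelianization *)

Section Tau.
Variables (G : grp) (k : nat) (g : 'I_k -> G).

Definition tauf (I : eqType) (i j : I) (x : G) : fungrp I G :=
  fun c => if c == i then x else if c == j then ginv x else gone.

(** The product of the entries of such a tuple is trivial in the abelianization of [G], whatever the
    order of the factors. *)
Definition Tau (I : eqType) : fungrp I G -> Prop :=
  gen (fun f => exists i j l, i != j /\ f = tauf i j (g l)).

Lemma Tau_subgroup I : is_subgroup (@Tau I). Proof. exact: gen_is_subgroup. Qed.

Lemma Tau_reindex (I J : eqType) (R : fungrp I G -> fungrp J G) (s : I -> J) :
  is_hom R -> injective s -> (forall i j x, R (tauf i j x) = tauf (s i) (s j) x) ->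
  forall f, Tau f -> Tau (R f).
Proof.
move=> hR si h; apply: (gen_hom hR (Tau_subgroup _)) => _ [i [j [l [ij ->]]]].
by rewrite h; apply: gen_in; exists (s i), (s j), l; rewrite (inj_eq si).
Qed.

Lemma Tau_tauf (I : eqType) (i j : I) l : i != j -> Tau (tauf i j (g l)).
Proof. by move=> ij; apply: gen_in; exists i, j, l. Qed.

Hypothesis hg : forall x, gen (fun y => exists i, y = g i) x.

(** The coordinate [None] is left free for an element [x] that is to be compared with its exponent
    vector. *)
Definition vec (n : 'rV[int]_k) : fungrp (option 'I_k) G :=
  fun c => if c is Some j then zpow (g j) (n ord0 j) else gone.

Lemma vecD m n : vec (m + n)%R = vec m ** vec n.
Proof.
apply: functional_extensionality => -[j|]; rewrite fun_mulE /= ?gmul1 //.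
by rewrite mxE zpowD.
Qed.

Lemma vecN n : vec (- n)%R = ginv (vec n).
Proof.
apply: functional_extensionality => -[j|]; rewrite fun_invE /= ?ginv1 //.
by rewrite mxE zpowN.
Qed.

Definition at_none (x : G) : fungrp (option 'I_k) G := fun c => if c is None then x else gone.

Lemma at_none_hom : is_hom at_none.
Proof.
by move=> x y; apply: functional_extensionality => -[j|]; rewrite fun_mulE /= ?gmul1.
Qed.

Lemma at_none_vec_comm x n : at_none x ** vec n = vec n ** at_none x.
Proof.
by apply: functional_extensionality => -[j|]; rewrite !fun_mulE /= ?gmul1 ?gmul1r.
Qed.

(* Modulo [Tau] all coordinates are identified and products become commutative, so [n] is an
   exponent vector of the image of [x] in the abelianization. *)
Definition expo (x : G) (n : 'rV[int]_k) := Tau (at_none x ** ginv (vec n)).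

Lemma expo_mul x y m n : expo x m -> expo y n -> expo (x ** y) (m + n)%R.
Proof.
rewrite /expo => h1 h2; have := subM (Tau_subgroup _) h1 h2; congr Tau.
rewrite -!vecN opprD vecD at_none_hom -!gmulA; congr (@gmul (fungrp _ _) _ _).
by rewrite !gmulA at_none_vec_comm.
Qed.

Lemma expo_inv x n : expo x n -> expo (ginv x) (- n)%R.
Proof.
move=> h; have := subV (Tau_subgroup _) h; rewrite /expo; congr Tau.
by rewrite ginvM ginvK (homV at_none_hom) vecN ginvK -(homV at_none_hom) at_none_vec_comm.
Qed.

Lemma expo_gen i : expo (g i) (delta_mx ord0 i).
Proof.
have := Tau_tauf (i := None) (j := Some i) i isT; rewrite /expo; congr Tau.
apply: functional_extensionality => -[j|]; rewrite fun_mulE fun_invE /=.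
  rewrite gmul1 mxE eqxx /= /tauf /=; have [ji|ji] := eqVneq j i.
    by rewrite ji eqxx /= gmul1r.
  by rewrite -[Some j == Some i]/(j == i) (negbTE ji) ginv1.
by rewrite ginv1 gmul1r.
Qed.

Lemma expo_total x : exists n, expo x n.
Proof.
have hS : is_subgroup (fun x => exists n, expo x n).
  split.
  - exists 0%R; rewrite /expo; have := sub1 (Tau_subgroup (option 'I_k)); congr Tau.
    rewrite (hom1 at_none_hom) gmul1 -[0%R]oppr0 vecN ginvK.
    by apply: functional_extensionality => -[j|] //=; rewrite mxE.
  - by move=> u v [m hm] [n hn]; exists (m + n)%R; exact: expo_mul.
  - by move=> u [m hm]; exists (- m)%R; exact: expo_inv.
by apply: (gen_min hS _ (hg x)) => _ [i ->]; exists (delta_mx ord0 i); exact: expo_gen.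
Qed.

(** By [expo_uniq], exponent vectors of one element are determined up to this lattice. *)
Definition Lam (n : 'rV[int]_k) := Tau (vec n).

Lemma Lam0 : Lam 0%R.
Proof.
rewrite /Lam; have := sub1 (Tau_subgroup (option 'I_k)); congr Tau.
by apply: functional_extensionality => -[j|] //=; rewrite mxE.
Qed.

Lemma LamB m n : Lam m -> Lam n -> Lam (m - n)%R.
Proof.
rewrite /Lam vecD vecN => hm hn; apply: (subM (Tau_subgroup _)) => //.
exact: (subV (Tau_subgroup _)).
Qed.

Lemma expo_uniq x m n : expo x m -> expo x n -> Lam (m - n)%R.
Proof.
rewrite /expo /Lam => h1 h2.
have := subM (Tau_subgroup _) (subV (Tau_subgroup _) h1) h2; congr Tau.
by rewrite ginvM ginvK -gmulA gmulKV vecD vecN.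
Qed.

(* The homomorphisms [chi] to the integers lift a multiple of the identity of the abelianized
   group, so the tuple made of [d] copies of [x] and the entries [g_j ^ - chi_j x] has trivial
   product in the abelianization. *)
Lemma balanced_tuple : exists (d : nat) (chi : G -> 'rV[int]_k),
  [/\ 0 < d, forall x y, chi (x ** y) = (chi x + chi y)%R &
      forall i, Lam (delta_mx ord0 i *+ d - chi (g i))%R].
Proof.
have [d [P [d0 hP hd]]] := lattice_projection Lam0 LamB.
(* A chosen exponent vector is additive only modulo [Lam]; multiplying by [P], which kills [Lam],
   makes it additive. *)
pose nf x := proj1_sig (constructive_indefinite_description _ (expo_total x)).
have nfP x : expo x (nf x) := proj2_sig (constructive_indefinite_description _ (expo_total x)).
have nfE x n : expo x n -> (nf x *m P = n *m P)%R.
  by move=> h; apply/eqP; rewrite -subr_eq0 -mulmxBl hP //; exact: expo_uniq h.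
exists d, (fun x => nf x *m P)%R; split=> // [x y|i].
  by rewrite -mulmxDl; apply: nfE; exact: expo_mul.
by rewrite (nfE _ _ (expo_gen i)) -rowE.
Qed.

(** Besides the [d] copies of [x] and the slots of [vec], four spare slots ensure that there are at
    least five points for the permutation arguments. *)
Definition slots d : finType := ('I_d + option 'I_k + 'I_4)%type.

Definition spread d (chi : G -> 'rV[int]_k) (x : G) : fungrp (slots d) G :=
  fun c => match c with
    | inl (inl _) => x
    | inl (inr (Some j)) => zpow (g j) (- chi x ord0 j)%R
    | _ => gone end.

(** The tuple is a product of two elements of [Tau]: [A d], with [g i] in the [d] copies balanced by
    its inverse [d]-th power in slot [i], and the lattice vector, which cancels this power and
    contributes the entries of [- chi]. *)
Lemma spread_Tau d chi : (forall i, Lam (delta_mx ord0 i *+ d - chi (g i))%R) ->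
  forall i, Tau (spread (d := d) chi (g i)).
Proof.
move=> hL i.
pose ext (f : fungrp (option 'I_k) G) : fungrp (slots d) G :=
  fun c => if c is inl (inr j) then f j else gone.
have ext_hom : is_hom ext.
  by move=> a b; apply: functional_extensionality => -[[l|j]|l]; rewrite fun_mulE /= ?gmul1.
have h1 : Tau (ext (vec (delta_mx ord0 i *+ d - chi (g i))%R)).
  apply: (Tau_reindex (s := fun j => inl (inr j)) ext_hom) (hL i); first by move=> a b [].
  by move=> a b x; apply: functional_extensionality => -[[l|j]|l].
pose A m : fungrp (slots d) G := fun c => match c with
  | inl (inl l) => if (l < m)%N then g i else gone
  | inl (inr j) => if j == Some i then ginv (gpow (g i) m) else gone
  | _ => gone end.
have hA m : (m <= d)%N -> Tau (A m).
  elim: m => [_|m IH hm].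
    have := sub1 (Tau_subgroup (slots d)); congr Tau.
    by apply: functional_extensionality => -[[l|j]|l] //=; rewrite ginv1; case: ifP.
  have := subM (Tau_subgroup _)
    (Tau_tauf (i := inl (inl (Ordinal hm))) (j := inl (inr (Some i)) : slots d) i isT) (IH (ltnW hm)).
  congr Tau; apply: functional_extensionality => -[[l|j]|l]; rewrite fun_mulE /tauf /=.
  - rewrite -[inl (inl l) == _]/(l == Ordinal hm) -val_eqE /=.
    by rewrite ltnS; case: ltngtP => _; rewrite ?gmul1r ?gmul1.
  - rewrite -[inl (inr j) == inl (inr _)]/(j == Some i).
    by case: eqP => _; rewrite ?gmul1 // -ginvM -gpowSr.
  - by rewrite gmul1.
have := subM (Tau_subgroup _) (hA d (leqnn d)) h1; congr Tau.
apply: functional_extensionality => -[[l|j]|l]; rewrite fun_mulE /=.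
- by rewrite ltn_ord gmul1r.
- case: j => [j|]; last by rewrite gmul1.
  rewrite /vec -scaler_nat !mxE eqxx /= -[Some j == Some i]/(j == i); have [->|ji] := eqVneq j i.
    by rewrite mulr1 natz zpowD gmulKV.
  by rewrite mulr0 add0r gmul1.
- by rewrite gmul1.
Qed.

Lemma spread_hom d chi : (forall x y, chi (x ** y) = (chi x + chi y)%R) -> is_hom (spread (d := d) chi).
Proof.
move=> h x y; apply: functional_extensionality => -[[l|[j|]]|l]; rewrite fun_mulE /= ?gmul1 //.
by rewrite h mxE opprD zpowD.
Qed.

End Tau.

(** * A finitely generated perfect subgroup of the wreath product *)

Section Wreath.
Variables (G : grp) (N : nat).

Definition wreath_car : Type := fungrp 'I_N G * 'S_N.
(* Permutations act on the left here, hence the reversed product of mathcomp permutations. *)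
Definition wreath_mul (x y : wreath_car) : wreath_car :=
  (fun c => x.1 c ** y.1 (x.2^-1%g c), (y.2 * x.2)%g).
Definition wreath_inv (x : wreath_car) : wreath_car := (fun c => ginv (x.1 (x.2 c)), (x.2^-1)%g).
Definition wreath_one : wreath_car := (fun=> gone, 1%g).

Lemma wreath_mulA x y z : wreath_mul x (wreath_mul y z) = wreath_mul (wreath_mul x y) z.
Proof.
rewrite /wreath_mul /= mulgA; congr (_, _); apply: functional_extensionality => c.
by rewrite gmulA invMg permM.
Qed.

Lemma wreath_mul1 x : wreath_mul wreath_one x = x.
Proof.
case: x => f s; rewrite /wreath_mul /= mulg1; congr (_, _); apply: functional_extensionality => c.
by rewrite gmul1 invg1 perm1.
Qed.

Lemma wreath_mulV x : wreath_mul (wreath_inv x) x = wreath_one.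
Proof.
case: x => f s; rewrite /wreath_mul /= mulgV; congr (_, _); apply: functional_extensionality => c.
by rewrite invgK gmulV.
Qed.

Definition wreath : grp := Grp wreath_mulA wreath_mul1 wreath_mulV.

Definition base (f : fungrp 'I_N G) : wreath := (f, 1%g).
Definition top (s : 'S_N) : wreath := (fun=> gone, s).

Lemma base_hom : is_hom base.
Proof.
move=> f h; congr (_, _); last by rewrite /= mulg1.
by apply: functional_extensionality => c /=; rewrite invg1 perm1.
Qed.

Lemma top_mul s t : top s ** top t = top (t * s)%g.
Proof. by congr (_, _); apply: functional_extensionality => c /=; rewrite gmul1. Qed.

Lemma top_inv s : ginv (top s) = top s^-1%g.
Proof. by congr (_, _); apply: functional_extensionality => c /=; rewrite ginv1. Qed.

Lemma top_conj f s : ginv (top s) ** base f ** top s = base (fun c => f (s c)).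
Proof.
rewrite top_inv; congr (_, _) => /=; last by rewrite mul1g mulgV.
by apply: functional_extensionality => c /=; rewrite gmul1 gmul1r invgK.
Qed.

Variables (k : nat) (g : 'I_k -> G).

Definition cyc3 (a b c : 'I_N) : 'S_N := (tperm a b * tperm a c)%g.

Lemma cyc3E a b c : uniq [:: a; b; c] ->
  [/\ cyc3 a b c a = b, cyc3 a b c b = c, cyc3 a b c c = a &
      forall x, x \notin [:: a; b; c] -> cyc3 a b c x = x].
Proof.
rewrite /= !inE negb_or andbT => /andP[/andP[ab ac] bc].
have [cb ca] : c != b /\ c != a by split; rewrite eq_sym.
rewrite /cyc3; split; rewrite ?permM.
- by rewrite tpermL tpermD.
- by rewrite tpermR tpermL.
- by rewrite (@tpermD _ a b c) // tpermR.
- move=> x; rewrite !inE !negb_or => /and3P[xa xb xc]; rewrite permM.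
  by rewrite !tpermD // eq_sym.
Qed.

Definition wgens (x : wreath) : Prop :=
  (exists a b c, uniq [:: a; b; c] /\ x = top (cyc3 a b c)) \/
  (exists i j l, i != j /\ x = base (tauf i j (g l))).

Definition W : wreath -> Prop := gen wgens.
Lemma W_subgroup : is_subgroup W. Proof. exact: gen_is_subgroup. Qed.

Lemma W_base f : Tau g f -> W (base f).
Proof.
apply: (gen_hom base_hom W_subgroup) => _ [i [j [l [ij ->]]]].
by apply: gen_in; right; exists i, j, l.
Qed.

Lemma W_cyc3 a b c : uniq [:: a; b; c] -> W (top (cyc3 a b c)).
Proof. by move=> h; apply: gen_in; left; exists a, b, c. Qed.

Definition WG : grp := gen_grp wgens.

Lemma WG_fg : finitely_generated WG.
Proof.
pose F3 (t : 'I_N * 'I_N * 'I_N) :=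
  if uniq [:: t.1.1; t.1.2; t.2] then top (cyc3 t.1.1 t.1.2 t.2) else gone.
pose Ft (t : 'I_N * 'I_N * 'I_k) :=
  if t.1.1 != t.1.2 then base (tauf t.1.1 t.1.2 (g t.2)) else gone.
apply: (@fg_subgrp _ _ _ (map F3 (enum {: 'I_N * 'I_N * 'I_N}) ++ map Ft (enum {: 'I_N * 'I_N * 'I_k}))).
  move=> x hx; case: (List.in_app_or _ _ _ hx) => hx'; have [z ->] := map_In hx'.
    by rewrite /F3; case: ifP => h; [exact: W_cyc3|exact: sub1 W_subgroup].
  by rewrite /Ft; case: ifP => h; [apply: W_base; exact: Tau_tauf|exact: sub1 W_subgroup].
apply: (@gen_sub wreath wgens) => _ [[a [b [c [h ->]]]]|[i [j [l [ij ->]]]]]; apply: gen_in;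
  apply: List.in_or_app; [left|right].
- have -> : top (cyc3 a b c) = F3 (a, b, c) by rewrite /F3 h.
  by apply: In_map; rewrite mem_enum.
- have -> : base (tauf i j (g l)) = Ft (i, j, l) by rewrite /Ft /= ij.
  by apply: In_map; rewrite mem_enum.
Qed.

Hypothesis N5 : 4 < N.

Lemma fresh (s : seq 'I_N) : size s < 5 -> exists x, x \notin s.
Proof.
move=> hs; apply: NNPP => h; have : #|'I_N| <= size s.
  apply: leq_trans (card_size s); apply: subset_leq_card; apply/subsetP => x _.
  by apply/negPn/negP => hx; apply: h; exists x.
by rewrite card_ord leqNgt (leq_trans hs N5).
Qed.

Lemma gcomm_eq (H : grp) (u v w : H) : u ** v = v ** u ** w -> gcomm u v = w.
Proof. by rewrite /gcomm => ->; rewrite -ginvM gmulKV. Qed.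

(** The two 3-cycles share only the point [c]. The identity is checked on the five points, all
    others being fixed by both sides. *)
Lemma cyc3_comm a b c d e : uniq [:: a; b; c; d; e] ->
  gcomm (top (cyc3 a c d)) (top (cyc3 b c e)) = top (cyc3 a b c).
Proof.
rewrite /= !inE !negb_or andbT => /and4P[/and4P[ab ac ad ae] /and3P[bc bd be] /andP[cd ce] de].
have sym (x y : 'I_N) : x != y -> (y == x) = false by rewrite eq_sym => /negbTE.
have neq := (negbTE ab, negbTE ac, negbTE ad, negbTE ae, negbTE bc, negbTE bd, negbTE be,
  negbTE cd, negbTE ce, negbTE de, sym _ _ ab, sym _ _ ac, sym _ _ ad, sym _ _ ae, sym _ _ bc,
  sym _ _ bd, sym _ _ be, sym _ _ cd, sym _ _ ce, sym _ _ de).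
have [|X1 X2 X3 X4] := @cyc3E a c d; first by rewrite /= !inE !neq.
have [|Y1 Y2 Y3 Y4] := @cyc3E b c e; first by rewrite /= !inE !neq.
have [|T1 T2 T3 T4] := @cyc3E a b c; first by rewrite /= !inE !neq.
have Xb : cyc3 a c d b = b by rewrite X4 // !inE !neq.
have Xe : cyc3 a c d e = e by rewrite X4 // !inE !neq.
have Ya : cyc3 b c e a = a by rewrite Y4 // !inE !neq.
have Yd : cyc3 b c e d = d by rewrite Y4 // !inE !neq.
have Td : cyc3 a b c d = d by rewrite T4 // !inE !neq.
have Te : cyc3 a b c e = e by rewrite T4 // !inE !neq.
set X := cyc3 a c d in X1 X2 X3 X4 Xb Xe *; set Y := cyc3 b c e in Y1 Y2 Y3 Y4 Ya Yd *.
set T := cyc3 a b c in T1 T2 T3 T4 Td Te *; clearbody X Y T.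
apply: (@gcomm_eq wreath); rewrite !top_mul; congr top; apply/permP => z; rewrite !permM.
have [->|za] := eqVneq z a; first by rewrite !(X1, X2, X3, Xb, Xe, Y1, Y2, Y3, Ya, Yd, T1, T2, T3, Td, Te).
have [->|zb] := eqVneq z b; first by rewrite !(X1, X2, X3, Xb, Xe, Y1, Y2, Y3, Ya, Yd, T1, T2, T3, Td, Te).
have [->|zc] := eqVneq z c; first by rewrite !(X1, X2, X3, Xb, Xe, Y1, Y2, Y3, Ya, Yd, T1, T2, T3, Td, Te).
have [->|zd] := eqVneq z d; first by rewrite !(X1, X2, X3, Xb, Xe, Y1, Y2, Y3, Ya, Yd, T1, T2, T3, Td, Te).
have [->|ze] := eqVneq z e; first by rewrite !(X1, X2, X3, Xb, Xe, Y1, Y2, Y3, Ya, Yd, T1, T2, T3, Td, Te).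
by rewrite T4 ?X4 ?Y4 ?X4 // !inE !negb_or ?za ?zb ?zc ?zd ?ze.
Qed.

(** The commutator is the inverse of the tuple times a permuted copy: the entries at [l] cancel, [x]
    remains at [i], and its inverse is carried from [i] to [j]. *)
Lemma tauf_comm i j l p x : uniq [:: i; j; l; p] ->
  gcomm (base (tauf l i x)) (top (cyc3 j i p)) = base (tauf i j x).
Proof.
rewrite /= !inE !negb_or andbT => /and3P[/and3P[ij il ip] /andP[jl jp] lp].
have sym (y z : 'I_N) : y != z -> (z == y) = false by rewrite eq_sym => /negbTE.
have neq := (negbTE ij, negbTE il, negbTE ip, negbTE jl, negbTE jp, negbTE lp,
  sym _ _ ij, sym _ _ il, sym _ _ ip, sym _ _ jl, sym _ _ jp, sym _ _ lp).
have [|E1 E2 E3 E4] := @cyc3E j i p; first by rewrite /= !inE !neq.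
rewrite /gcomm -(gmulA (ginv _)) (gmulA (ginv (top _))) top_conj.
rewrite -(homV base_hom) -base_hom; congr base; apply: functional_extensionality => c.
rewrite fun_mulE fun_invE /tauf.
have [->|ci] := eqVneq c i; first by rewrite E2 !neq ginvK gmul1r.
have [->|cj] := eqVneq c j; first by rewrite E1 !neq eqxx ginv1 gmul1.
have [->|cp] := eqVneq c p; first by rewrite E3 !neq ginv1 gmul1.
by rewrite E4 ?inE ?negb_or ?cj ?ci ?cp // (negbTE ci); case: ifP; rewrite ?gmulV ?ginv1 ?gmul1.
Qed.

Lemma WG_perfect : perfect WG.
Proof.
apply: perfect_subgrp; apply: (@gen_sub wreath wgens) => _ [[a [b [c [h ->]]]]|[i [j [l [ij ->]]]]];
  apply: gen_in.
- have [d hd] := @fresh [:: a; b; c] isT; have [e he] := @fresh [:: a; b; c; d] isT.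
  have hu : uniq [:: a; b; c; d; e].
    rewrite -[uniq _]/(uniq (rcons [:: a; b; c; d] e)) rcons_uniq he.
    by rewrite -[uniq _]/(uniq (rcons [:: a; b; c] d)) rcons_uniq hd.
  exists (top (cyc3 a c d)), (top (cyc3 b c e)); rewrite cyc3_comm //; split=> //; apply: W_cyc3.
    exact: (mask_uniq hu [:: true; false; true; true]).
  exact: (mask_uniq hu [:: false; true; true; false; true]).
- have [p hp] := @fresh [:: i; j] isT; have [q hq] := @fresh [:: i; j; p] isT.
  have hu : uniq [:: i; j; p; q].
    rewrite -[uniq _]/(uniq (rcons [:: i; j; p] q)) rcons_uniq hq.
    by rewrite -[uniq _]/(uniq (rcons [:: i; j] p)) rcons_uniq hp /= inE ij.
  move: hp; rewrite !inE negb_or => /andP[pi pj].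
  exists (base (tauf p i (g l))), (top (cyc3 j i q)); rewrite (tauf_comm _ hu); split=> //.
    by apply: W_base; exact: Tau_tauf.
  apply: W_cyc3; have := mask_uniq hu [:: true; true; false; true].
  by rewrite /= !inE !negb_or (eq_sym j i); case/and3P=> /andP[-> ->] -> _.
Qed.

Definition WG_perm (x : WG) : 'S_N := (proj1_sig x).2.

Lemma WG_perm1 c : WG_perm gone c = c. Proof. exact: perm1. Qed.

Lemma WG_permM a b : WG_perm (a ** b) = (WG_perm b * WG_perm a)%g.
Proof. by []. Qed.

Lemma WG_permV a : WG_perm (ginv a) = (WG_perm a)^-1%g.
Proof. by []. Qed.

Definition WG_at (x : WG) (c : 'I_N) : G := (proj1_sig x).1 c.

Lemma WG_atM a b c : WG_at (a ** b) c = WG_at a c ** WG_at b ((WG_perm a)^-1%g c).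
Proof. by []. Qed.

Lemma WG_atV a c : WG_at (ginv a) c = ginv (WG_at a (WG_perm a c)).
Proof. by []. Qed.

Lemma WG_eq1 a : WG_perm a = 1%g -> (forall c, WG_at a c = gone) -> a = gone.
Proof.
case: a => [[f s] h] /= hs hf; apply: sig_inj; rewrite /= (hs : s = 1%g).
by congr (_, _); apply: functional_extensionality.
Qed.

(** A 3-cycle through [b], [c] and a fourth point leaves [a] fixed. *)
Lemma WG_perm2 a b c : a <> b -> a <> c -> exists x, WG_perm x a = a /\ WG_perm x b = c.
Proof.
move=> /eqP ab /eqP ac; have [<-|bc] := eqVneq b c.
  by exists gone; rewrite !WG_perm1.
have [d hd] := @fresh [:: a; b; c] isT; move: hd; rewrite !inE !negb_or => /and3P[da db dc].
have hu : uniq [:: b; c; d] by rewrite /= !inE negb_or bc !(eq_sym _ d) db dc.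
exists (exist _ _ (W_cyc3 hu)); have [E1 _ _ E4] := cyc3E hu.
by rewrite /WG_perm /= E1 E4 // !inE !negb_or ab ac eq_sym da.
Qed.

(** An element with nontrivial permutation is excluded by the base subgroup. Otherwise some entry is
    nontrivial, and a finite index subgroup of [G] excluding it is imposed on that coordinate. *)
Lemma WG_rf : residually_finite G ->
  forall b : WG, b <> gone -> exists M, [/\ is_subgroup M, finite_index M & ~ M b].
Proof.
move=> hG b hb; have [sb|sb] := eqVneq (WG_perm b) 1%g; last first.
  exists (fun x => WG_perm x = 1%g); split; last exact/eqP.
  - split=> [//|x y hx hy|x hx]; first by rewrite WG_permM hx hy mulg1.
    by rewrite WG_permV hx invg1.
  - apply: (@finite_index_by _ _ _ WG_perm) => x y e.
    by rewrite WG_permM WG_permV e mulgV.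
have [c hc] : exists c, WG_at b c <> gone.
  apply: NNPP => h; apply: hb; apply: WG_eq1 => // c.
  by apply: NNPP => hc; apply: h; exists c.
have [M [[hM _] fM nM]] := hG _ hc.
exists (fun x : WG => WG_perm x = 1%g /\ M (WG_at x c)); split; last by case.
  split.
  - by split=> //; exact: (sub1 hM).
  - move=> x y [hx mx] [hy my]; split; first by rewrite WG_permM hx hy mulg1.
    by rewrite WG_atM hx invg1 perm1; exact: (subM hM).
  - move=> x [hx mx]; split; first by rewrite WG_permV hx invg1.
    by rewrite WG_atV hx perm1; exact: (subV hM).
have [n [r hr]] := fM.
pose ci z := proj1_sig (constructive_indefinite_description _ (hr z)).
have ciP z : M (ginv (r (ci z)) ** z) := proj2_sig (constructive_indefinite_description _ (hr z)).
(* The entry at [c] of the inverse of [x] times [y] compares their entries at [WG_perm x c], so the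
   coset is recorded at that coordinate. *)
apply: (@finite_index_by _ _ _ (fun x : WG => (WG_perm x, ci (WG_at x (WG_perm x c))))).
move=> x y [e1 e2]; split; first by rewrite WG_permM WG_permV e1 mulgV.
rewrite WG_atM WG_atV WG_permV invgK.
have := subM hM (subV hM (ciP (WG_at x (WG_perm x c)))) (ciP (WG_at y (WG_perm y c))).
by rewrite e2 ginvM ginvK -gmulA gmulK e1.
Qed.

(** Powers with exponent the factorial of [N] lie in the base, where the hypothesis on [G] is
    applied in each coordinate; the product of the exponents serves all coordinates. *)
Lemma WG_powC (C : grp -> Prop) : group_class C -> subgroup_closed C -> dirprod_closed C ->
  locally_up_to_powers C G -> locally_up_to_powers C WG.
Proof.
move=> Ciso Csub Cprod hG n x.
pose u i : WG := gpow (x i) N`!.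
have permX' (a : WG) m : WG_perm (gpow a m) = (WG_perm a ^+ m)%g.
  by elim: m => //= m IH; rewrite WG_permM IH -expgSr.
have u2 i : WG_perm (u i) = 1%g.
  by rewrite /u permX'; apply/permP => c; rewrite permX perm_iter_fact perm1.
have hc c := constructive_indefinite_description _ (hG n (fun i => WG_at (u i) c)).
pose t c := proj1_sig (hc c).
have tP c : (forall i, 0 < t c i) /\
  C (gen_grp (fun z => exists i, z = gpow (WG_at (u i) c) (t c i))) := proj2_sig (hc c).
pose T i := \prod_c t c i.
exists (fun i => N`! * T i); split=> [i|].
  by rewrite muln_gt0 fact_gt0; apply: prodn_gt0 => c; case: (tP c).
pose S : WG -> Prop := gen (fun z => exists i, z = gpow (x i) (N`! * T i)).
pose V c : G -> Prop := gen (fun z => exists i, z = gpow (WG_at (u i) c) (t c i)).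
have mul1 a b c : WG_perm a = 1%g -> WG_at (a ** b) c = WG_at a c ** WG_at b c.
  by move=> ha; rewrite WG_atM ha invg1 perm1.
have SV c b : S b -> WG_perm b = 1%g /\ V c (WG_at b c).
  have hV : is_subgroup (V c) by exact: gen_is_subgroup.
  have hW : is_subgroup (fun b => WG_perm b = 1%g /\ V c (WG_at b c)).
    split.
    - by split=> //; exact: (sub1 hV).
    - move=> a d [ha va] [hd vd]; split; first by rewrite WG_permM ha hd mulg1.
      by rewrite mul1 //; exact: (subM hV).
    - move=> a [ha va]; split; first by rewrite WG_permV ha invg1.
      by rewrite WG_atV ha perm1; exact: (subV hV).
  apply: (gen_min hW) => _ [i ->]; rewrite gpowM -/(u i).
  split; first by rewrite permX' u2 expg1n.
  have -> m : WG_at (gpow (u i) m) c = gpow (WG_at (u i) c) m.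
    by elim: m => [//|m IH]; rewrite /= mul1 // IH.
  rewrite /T (bigD1 c) //= gpowM; apply: (sub_pow _ hV).
  by apply: gen_in; exists i.
have [K [_ CK]] := hG 0 (fun=> gone).
apply: (@C_family C Ciso Csub Cprod _ G WG (enum 'I_N) S _ V (fun c b => WG_at b c)).
- by exists (gen_grp (fun z => exists i : 'I_0, z = gpow (gone : G) (K i))).
- by move=> c; exact: gen_is_subgroup.
- by move=> c hV _; have [_ h] := tP c; rewrite (proof_irrelevance _ hV (gen_is_subgroup _)).
- by move=> c b _ hb; have [] := SV c b hb.
- by move=> c a b ha _; apply: mul1; have [] := SV c a ha.
- move=> b hb h; apply: WG_eq1 => [|c]; last by apply: h; rewrite mem_enum.
  have c0 : 'I_N := Ordinal (leq_ltn_trans (leq0n 4) N5).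
  by have [] := SV c0 b hb.
Qed.

End Wreath.

Theorem theorem3p4 (C : grp -> Prop) (G : grp) :
  group_class C -> subgroup_closed C -> dirprod_closed C ->
  finitely_generated G -> residually_finite G -> locally_up_to_powers C G ->
  exists Gam : grp,
    [/\ embeds G Gam, finitely_generated Gam, perfect Gam,
        branch_group Gam & locally_up_to_powers C Gam].
Proof.
move=> Ciso Csub Cprod [k [g hg]] Grf GC.
have [d [chi [d0 chiM hchi]]] := balanced_tuple hg.
pose K := slots k d; pose N := #|K|.
have N5 : 4 < N.
  by rewrite /N !card_sum !card_ord card_option card_ord; lia.
pose R (f : fungrp K G) : fungrp 'I_N G := fun c => f (enum_val c).
have R_hom : is_hom R by [].
have spread_W i : W g (base (R (spread (d := d) g chi (g i)))).
  apply: W_base; apply: (Tau_reindex R_hom (@enum_rank_inj K)) (spread_Tau hchi i).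
  move=> a b x; apply: functional_extensionality => c; rewrite /R /tauf.
  by rewrite -!(can2_eq (@enum_valK K) (@enum_rankK K)).
have hom : is_hom (fun x => base (R (spread (d := d) g chi x))).
  by move=> x y; rewrite spread_hom // R_hom base_hom.
have WG_emb x : W g (base (R (spread (d := d) g chi x))).
  by have := hg x; apply: (gen_hom hom (@W_subgroup G N k g)) => _ [i ->].
have [||||||Gam [eG fG pG bG lG]] := @branch_overgroup C (@WG G N k g) N (@WG_perm G N k g)
  Ciso Csub Cprod (@WG_fg G N k g) (@WG_perfect G N k g N5).
- exact: WG_powC.
- exact: WG_rf.
- by move=> c; exact: perm1.
- by move=> a b c; rewrite WG_permM permM.
- by move=> a b c ab ac; exact: WG_perm2.
- exact: ltnW (ltnW N5).
exists Gam; split=> //.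
have [f [hf fi]] := eG.
exists (fun x => f (exist _ _ (WG_emb x))); split.
  by move=> x y; rewrite -hf; congr f; apply: sig_inj; exact: hom.
move=> x y /fi /(congr1 (@proj1_sig _ _)) /= e.
(* The tuple contains [x] itself in the first of the [d] copies, which exists because [d] is
   positive. *)
have := congr1 (fun w : wreath G N => w.1 (enum_rank (inl (inl (Ordinal d0)) : K))) e.
by rewrite /= /R enum_rankK.
Qed.
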